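(* Let $n\ge1$, $a_0>0$, $a_1<0$ and $\sigma>-1+2/n$ (so that $T_1=T_0>0$). Let $\lambda\in\mathbb{R}$, $1<p<\infty$, and let $f(Y)=\lambda|Y|^{p-1}Y$ or $f(Y)=\lambda|Y|^p$. For $Y_0,Y_1\in\mathbb{R}^n$ put $D':=|Y_0|+A(0)^{-1/2}|Y_1|$. Consider the Cauchy problem $$D_t^2Y(t)+A(t)Y(t)+f(Y)(t)=0,\qquad Y(0)=Y_0,\quad D_tY(0)=Y_1. \qquad (\mathrm{CP})$$ Then there exist constants $C_0>0$ and $C>0$, independent of $Y_0$ and $Y_1$, such that the following hold. (1) For any $Y_0,Y_1\in\mathbb{R}^n$ there exists $T$ with $0<T<T_1$ such that (CP) has a unique solution $Y\in X'(T,C_0D')$, where $T$ can be taken arbitrarily under the condition $$\frac{C|\lambda|a_0T}{|a_1|}\cdot\left(1-\frac{T}{2T_0}\right)\cdot(C_0D')^{p-1}\le1.$$ (2) If $D'$ is sufficiently small that $$\frac{2C|\lambda|a_0^2}{n(1+\sigma)|a_1|^2}\cdot(C_0D')^{p-1}\le1,$$ then the solution $Y$ in (1) is a global solution; namely, $T$ can be taken as $T=T_1$. (3) The solution $Y$ in (1) satisfies $Y\in C^1([0,T))$. (4) The solution $Y$ in (1) is unique in $C^1([0,T))\cap X'(T)$. (5) If $\lambda\ge0$ and $f(Y)=\lambda|Y|^{p-1}Y$, then the solution $Y$ in (1) is a global solution.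
   Context: $D_t:=d/dt$. For $n\ge1$, $a_0>0$, $a_1,\sigma\in\mathbb{R}$: if $\sigma\ne-1$ and $a_1\neq 0$ put $T_0:=-\frac{2a_0}{n(1+\sigma)a_1}$; put $T_1:=T_0$ if $(1+\sigma)a_1<0$ and $T_1:=\infty$ if $(1+\sigma)a_1\ge0$. The scale-function is, for $0\le t<T_1$, $a(t):=a_0\left(1+\frac{n(1+\sigma)a_1t}{2a_0}\right)^{2/(n(1+\sigma))}$ if $\sigma\neq-1$ and $a(t):=a_0e^{a_1t/a_0}$ if $\sigma=-1$. Put $q_0(t):=\frac{D_t(a(t)^2)}{a(t)^2}$ and $A(t):=-\frac14q_0(t)^2-\frac12D_tq_0(t)$. Under the hypotheses of the theorem $A>0$ and $D_tA>0$ on $[0,T_1)$. $Y=(Y^1,\dots,Y^n)$ is $\mathbb{R}^n$-valued and $|Y|=\{\sum_{j=1}^n(Y^j)^2\}^{1/2}$. In the case $f(Y)=\lambda|Y|^p$ the equation is read componentwise, every component of $f(Y)$ being $\lambda|Y|^p$. For $0<T\le T_1$ and $R\ge0$: $\|Y\|_{X'(T)}:=\|A^{-1/2}D_tY\|_{L^\infty((0,T))}+\|Y\|_{L^\infty((0,T))}+\|A^{-1}\sqrt{D_tA}\,D_tY\|_{L^2((0,T))}$, $X'(T):=\{Y:\|Y\|_{X'(T)}<\infty\}$, $X'(T,R):=\{Y:\|Y\|_{X'(T)}\le R\}$. A solution of (CP) on $[0,T)$ means a fixed point of the integral operator $\Psi(Y)^j(t):=\rho_0(t)Y_0^j+\rho_1(t)Y_1^j-\int_0^t\rho_{12}(t,s)f(Y)^j(s)\,ds$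 ($1\le j\le n$), where $\rho_0,\rho_1$ solve $(D_t^2+A(t))\rho_i=0$ with $\rho_0(0)=1$, $D_t\rho_0(0)=0$, $\rho_1(0)=0$, $D_t\rho_1(0)=1$, and $\rho_{12}(t,s):=-\rho_0(t)\rho_1(s)+\rho_1(t)\rho_0(s)$. A global solution is one that exists on $[0,T_1)$. *)

(* Defs.v *)
From HB Require Import structures.
From mathcomp Require Import all_boot all_order all_algebra.
From mathcomp Require Import all_classical all_reals all_analysis.
Set Implicit Arguments.
Unset Strict Implicit.
Unset Printing Implicit Defensive.
Import Order.TTheory GRing.Theory Num.Theory.
Import numFieldNormedType.Exports.
Local Open Scope classical_set_scope.
Local Open Scope ring_scope.

(* The end time [T] may be infinite. *)
Definition Ico0 (R : realType) (T : \bar R) : set R :=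
  [set t | 0 <= t /\ (t%:E < T)%E].
Definition Ioo0 (R : realType) (T : \bar R) : set R :=
  [set t | 0 < t /\ (t%:E < T)%E].

(* [g] is the derivative of [f] on [I]; at an endpoint that belongs to [I]
   the derivative is one-sided. *)
Definition has_deriv_on (R : realType) (I : set R) (f g : R -> R) : Prop :=
  forall t, I t ->
    (fun s => (f s - f t) / (s - t)) @ within I t^' --> g t.

Section ScaleFunction.
Context (R : realType) (n : nat) (a0 a1 sigma : R).

(* Meaningful only if [sigma != -1] and [a1 != 0]. *)
Definition T0 : R := - (2 * a0 / (n%:R * (1 + sigma) * a1)).

Definition T1 : \bar R :=
  if (1 + sigma) * a1 < 0 then T0%:E else +oo%E.

(* The formula also makes sense for small negative [t], so that the two-sided
   derivatives below agree at [t = 0] with the one-sided ones. *)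
Definition scale (t : R) : R :=
  if sigma == -1 then a0 * expR (a1 * t / a0)
  else a0 * (1 + n%:R * (1 + sigma) * a1 * t / (2 * a0))
              `^ (2 / (n%:R * (1 + sigma))).

Definition q0 (t : R) : R :=
  derive1 (fun s => scale s ^+ 2) t / scale t ^+ 2.

Definition A (t : R) : R := - (4^-1 * q0 t ^+ 2) - 2^-1 * derive1 q0 t.

Definition linear_ivp (y0 y1 : R) (r : R -> R) : Prop :=
  exists r' : R -> R,
    [/\ has_deriv_on (Ico0 T1) r r',
        has_deriv_on (Ico0 T1) r' (fun t => - (A t * r t)),
        r 0 = y0 & r' 0 = y1].

(* Solutions of the linear problem are unique on [0, T1); their values
   elsewhere are never used. *)
Definition rho0 : R -> R := xget (fun=> 0) [set r | linear_ivp 1 0 r].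
Definition rho1 : R -> R := xget (fun=> 0) [set r | linear_ivp 0 1 r].

Definition rho12 (t s : R) : R := - (rho0 t * rho1 s) + rho1 t * rho0 s.

End ScaleFunction.

Section VectorValued.
Context (R : realType) (n : nat).

Definition enorm (v : 'rV[R]_n) : R := Num.sqrt (\sum_(j < n) v 0 j ^+ 2).

Definition f_vec (lambda p : R) (v : 'rV[R]_n) : 'rV[R]_n :=
  (lambda * enorm v `^ (p - 1)) *: v.
Definition f_abs (lambda p : R) (v : 'rV[R]_n) : 'rV[R]_n :=
  const_mx (lambda * enorm v `^ p).

Definition C1_on (I : set R) (Y : R -> 'rV[R]_n) : Prop :=
  exists V : R -> 'rV[R]_n, forall j : 'I_n,
    has_deriv_on I (fun t => Y t 0 j) (fun t => V t 0 j) /\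
    {within I, continuous (fun t => V t 0 j)}.

Definition test_function (T : \bar R) (phi : R -> R) : Prop :=
  (forall k x, derivable (derive1n k phi) x 1) /\
  exists a b : R, [/\ 0 < a, (b%:E < T)%E &
    forall x, ~~ (a <= x <= b) -> phi x = 0].

Definition loc_integrable (T : \bar R) (u : R -> R) : Prop :=
  measurable_fun (Ioo0 T) u /\
  forall a b : R, 0 < a -> (b%:E < T)%E ->
    (@lebesgue_measure R).-integrable `[a, b] (EFin \o u).

(* [V] is the distributional derivative of [Y] on (0, T). *)
Definition weak_deriv (T : \bar R) (Y V : R -> 'rV[R]_n) : Prop :=
  forall j : 'I_n,
    [/\ loc_integrable T (fun t => Y t 0 j),
        loc_integrable T (fun t => V t 0 j) &
        forall phi, test_function T phi ->
          \int[@lebesgue_measure R]_(t in Ioo0 T) (Y t 0 j * derive1 phi t) =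
          - \int[@lebesgue_measure R]_(t in Ioo0 T) (V t 0 j * phi t)].

(* The norm of L^q((0, T)), of a scalar function. *)
Definition Lnorm_Ioo (T : \bar R) (q : \bar R) (u : R -> R) : \bar R :=
  'N[@lebesgue_measure R]_q[EFin \o (u \_ (Ioo0 T))].

Context (a0 a1 sigma : R).

(* Here [V] stands for the derivative of [Y]. *)
Definition X'norm (T : \bar R) (Y V : R -> 'rV[R]_n) : \bar R :=
  let a := A n a0 a1 sigma in
  let u1 t := (Num.sqrt (a t))^-1 * enorm (V t) in
  let u2 t := (a t)^-1 * Num.sqrt (derive1 a t) * enorm (V t) in
  (Lnorm_Ioo T +oo u1 + Lnorm_Ioo T +oo (fun t => enorm (Y t))
   + Lnorm_Ioo T 2%:E u2)%E.

(* The weak derivative is unique up to null sets, so that the norm does not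
   depend on the choice of [V]. *)
Definition X' (T : \bar R) : set (R -> 'rV[R]_n) :=
  [set Y | exists V, weak_deriv T Y V /\ (X'norm T Y V < +oo)%E].
Definition X'ball (T : \bar R) (r : R) : set (R -> 'rV[R]_n) :=
  [set Y | exists V, weak_deriv T Y V /\ (X'norm T Y V <= r%:E)%E].

Definition Psi (f : 'rV[R]_n -> 'rV[R]_n) (Y0 Y1 : 'rV[R]_n)
    (Y : R -> 'rV[R]_n) (t : R) : 'rV[R]_n :=
  \row_j (rho0 n a0 a1 sigma t * Y0 0 j + rho1 n a0 a1 sigma t * Y1 0 j
    - \int[@lebesgue_measure R]_(s in `[0, t])
        (rho12 n a0 a1 sigma t s * f (Y s) 0 j)).

Definition solution f Y0 Y1 (T : \bar R) (Y : R -> 'rV[R]_n) : Prop :=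
  forall t, Ico0 T t -> Y t = Psi f Y0 Y1 Y t.

(* Functions are identified when they agree on [0, T). *)
Definition exists_unique_solution f Y0 Y1 (T : \bar R)
    (S : set (R -> 'rV[R]_n)) : Prop :=
  exists Y, [/\ S Y, solution f Y0 Y1 T Y &
    forall Z, S Z -> solution f Y0 Y1 T Z -> {in Ico0 T, Z =1 Y}].

Definition Dprime (Y0 Y1 : 'rV[R]_n) : R :=
  enorm Y0 + (Num.sqrt (A n a0 a1 sigma 0))^-1 * enorm Y1.

End VectorValued.

(* Main.v *)
Require Import Defs.
From HB Require Import structures.
From mathcomp Require Import all_boot all_order all_algebra.
From mathcomp Require Import all_classical all_reals all_analysis.
From mathcomp Require Import measurable_realfun ess_sup_inf.
From mathcomp Require Import ring lra.
Import Order.TTheory GRing.Theory Num.Theory.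
Import numFieldNormedType.Exports.
Local Open Scope classical_set_scope.
Local Open Scope ring_scope.
Set Implicit Arguments.
Unset Strict Implicit.
Unset Printing Implicit Defensive.

(** Put r = 2 / (n (1 + sigma)), so that 0 < r < 1.  Then the scale function is
    a0 (1 - t / T0)^r and A(t) = kappa / (T0 - t)^2 with kappa = r (1 - r).  The
    linear equation is of Euler type, hence explicitly solvable, and 1 / A is a
    decreasing polynomial on [0, T0).

    Duhamel's formula turns a solution of the integral equation that is
    measurable and essentially bounded (which is all that is used of X') into
    a classical C^1 solution of Y' = V, V' = - A Y - f(Y) ([sol_cts],
    [sol_ode], [X'_ode]).  As f is locally Lipschitz, a Gronwall argument shows
    that such solutions are determined by their data, whichever ball or
    interval they come from ([ode_unique], [solution_unique]).  This gives all
    the uniqueness claims, and the regularity.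

    For existence, f(Y) = lambda |Y|^(p-1) e(Y), with e(Y) = Y or e(Y) = |Y|
    in every component, is replaced by f_M(Y) = lambda min(|Y|, M)^(p-1) e(Y),
    which is globally Lipschitz.  The fundamental solutions are bounded on
    [0, T0), so Picard iteration in a weighted sup norm solves the truncated
    problem on all of [0, T0) ([picard], [trunc_solution]).  An a priori bound
    |Y| <= M then shows that the truncation was not active.  The bound comes
    from the energy E = |Y|^2 + |V|^2 / A, for which
      E' + (A' / A^2) |V|^2 = - (2 / A) V . f_M(Y),
    where the integral of (A' / A^2) |V|^2 is the square of the third part of
    the X' norm.  Two ways of controlling the right-hand side are needed.

    - In general |f_M(Y)| <= L |Y| with L = sqrt(n) |lambda| M^(p-1), so the
      right-hand side is at most L A^(-1/2) E, and Gronwall gives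
      E(t) <= E(0) exp (L int_0^t A^(-1/2)) ([energy_small]).  The exponent is
      exactly what the conditions in (1) and (2) bound, because
      int_0^T A^(-1/2) = kappa^(-1/2) T0 T (1 - T / (2 T0)); see
      [local_time_growth] and [small_growth].
    - If lambda >= 0 and e(Y) = Y, the right-hand side is absorbed by adding to
      E the potential energy divided by A; the sum is dissipated at least at
      the linear rate, since A increases ([defocusing_bound]).  The resulting bound does not depend on
      M, and the solution is global for all data ([global_solution]). *)

(** * One-sided derivatives and continuity on subsets of the line *)

(** Continuity of [u] relative to [I] at every point of [I]. *)
Definition cts_on (R : realType) (I : set R) (u : R -> R) : Prop :=
  forall t, I t -> u s @[s --> within I (nbhs t)] --> u t.

Lemma cts_onP (R : realType) (I : set R) (u : R -> R) :
  cts_on I u <-> {within I, continuous u}.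
Proof. by split => /subspace_continuousP. Qed.

(** Continuity in epsilon-delta form, with a non-strict conclusion. *)
Lemma cts_onE (R : realType) (I : set R) (u : R -> R) :
  cts_on I u <-> (forall t, I t -> forall e : R, 0 < e -> exists2 d : R, 0 < d &
    forall s, I s -> `|s - t| < d -> `|u s - u t| <= e).
Proof.
split=> h t It.
- move=> e e0; have /cvgrPdist_le/(_ e e0) := h t It.
  rewrite near_withinE => -[d /= d0 hd]; exists d => // s Is st.
  by rewrite distrC; apply: hd => //=; rewrite distrC.
- apply/cvgrPdist_le => e e0; have [d d0 hd] := h t It e e0.
  rewrite near_withinE; exists d => //= s /= st Is.
  by rewrite distrC; apply: hd => //; rewrite distrC.
Qed.

(** The derivative as first-order expansion, which avoids dividing by [s - t]. *)
Lemma has_derivP (R : realType) (I : set R) (f g : R -> R) :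
  has_deriv_on I f g <->
  (forall t, I t -> forall e : R, 0 < e -> exists2 d : R, 0 < d &
    forall s, I s -> `|s - t| < d ->
    `|f s - f t - g t * (s - t)| <= e * `|s - t|).
Proof.
split=> h t It.
- move=> e e0; have /cvgrPdist_le/(_ e e0) := h t It.
  rewrite !near_withinE => -[d /= d0 hd]; exists d => // s Is st.
  have [->|nst] := eqVneq s t; first by rewrite !subrr mulr0 subr0 normr0 mulr0.
  have := hd s; rewrite /= distrC => /(_ st nst Is).
  have st0 : 0 < `|s - t| by rewrite normr_gt0 subr_eq0.
  rewrite -(ler_pM2r st0) -normrM mulrBl divfK ?subr_eq0// => le.
  by rewrite -normrN opprB.
- apply/cvgrPdist_le => e e0; have [d d0 hd] := h t It e e0.
  rewrite !near_withinE; exists d => //= s /= st nst Is.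
  have st0 : 0 < `|s - t| by rewrite normr_gt0 subr_eq0.
  rewrite -(ler_pM2r st0) -normrM mulrBl divfK ?subr_eq0//.
  by rewrite -normrN opprB; apply: hd => //; rewrite distrC.
Qed.

Lemma le_of_eq (R : realType) (x y : R) : x = y -> x <= y.
Proof. by move->. Qed.

Section calculus.
Context (R : realType).
Implicit Types (I J : set R) (f g u v : R -> R).

Lemma cts_onS I J u : I `<=` J -> cts_on J u -> cts_on I u.
Proof.
move=> IJ /cts_onE h; apply/cts_onE => t It e e0.
have [d d0 hd] := h t (IJ _ It) e e0; exists d => // s Is; exact/hd/IJ.
Qed.

Lemma has_derivS I J u u' : I `<=` J -> has_deriv_on J u u' ->
  has_deriv_on I u u'.
Proof.
move=> IJ /has_derivP h; apply/has_derivP => t It e e0.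
have [d d0 hd] := h t (IJ _ It) e e0; exists d => // s Is; exact/hd/IJ.
Qed.

Lemma eq_cts_on I u v : (forall t, I t -> u t = v t) -> cts_on I u -> cts_on I v.
Proof.
move=> uv /cts_onE h; apply/cts_onE => t It e e0.
have [d d0 hd] := h t It e e0; exists d => // s Is st.
by rewrite -!uv//; exact: hd.
Qed.

Lemma eq_has_deriv I u v u' v' : (forall t, I t -> u t = v t) ->
  (forall t, I t -> u' t = v' t) -> has_deriv_on I u u' -> has_deriv_on I v v'.
Proof.
move=> uv uv' /has_derivP h; apply/has_derivP => t It e e0.
have [d d0 hd] := h t It e e0; exists d => // s Is st.
by rewrite -!uv// -uv'//; exact: hd.
Qed.

Lemma cts_cst I c : cts_on I (fun=> c).
Proof. by move=> t It; exact: cvg_cst. Qed.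

Lemma cts_id I : cts_on I id.
Proof. by move=> t It; exact: cvg_within. Qed.

Lemma cts_add I u v : cts_on I u -> cts_on I v -> cts_on I (fun t => u t + v t).
Proof. by move=> hu hv t It; apply: cvgD; [exact: hu|exact: hv]. Qed.

Lemma cts_opp I u : cts_on I u -> cts_on I (fun t => - u t).
Proof. by move=> hu t It; apply: cvgN; exact: hu. Qed.

Lemma cts_sub I u v : cts_on I u -> cts_on I v -> cts_on I (fun t => u t - v t).
Proof. by move=> hu hv; apply: cts_add => //; exact: cts_opp. Qed.

Lemma cts_mul I u v : cts_on I u -> cts_on I v -> cts_on I (fun t => u t * v t).
Proof. by move=> hu hv t It; apply: cvgM; [exact: hu|exact: hv]. Qed.

Lemma cts_sum (T : finType) I (u : T -> R -> R) : (forall i, cts_on I (u i)) ->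
  cts_on I (fun t => \sum_i u i t).
Proof.
move=> hu; suff h : forall r : seq T, cts_on I (fun t => \sum_(i <- r) u i t) by exact: h.
elim=> [|i r ih].
  by under eq_fun do rewrite big_nil; exact: cts_cst.
by under eq_fun do rewrite big_cons; apply: cts_add.
Qed.

Lemma cts_comp I u (F : R -> R) : continuous F -> cts_on I u ->
  cts_on I (fun t => F (u t)).
Proof. by move=> cF hu t It; apply: continuous_cvg; [exact: cF|exact: hu]. Qed.

Lemma has_deriv_cts I u u' : has_deriv_on I u u' -> cts_on I u.
Proof.
move=> /has_derivP h; apply/cts_onE => t It e e0.
have [d d0 hd] := h t It 1 ltr01.
have k0 : 0 < 1 + `|u' t| by rewrite ltr_pwDl.
exists (Num.min d (e / (1 + `|u' t|))).
  by rewrite lt_min d0 divr_gt0.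
move=> s Is; rewrite lt_min => /andP[st1 st2].
have := hd s Is st1; rewrite mul1r => hs.
rewrite ltr_pdivlMr// in st2.
have -> : u s - u t = (u s - u t - u' t * (s - t)) + u' t * (s - t) by ring.
apply: (le_trans (ler_normD _ _)); rewrite normrM.
apply: le_trans (ltW st2).
by rewrite [leRHS]mulrDr mulr1 lerD// mulrC.
Qed.

Lemma has_deriv_cst I c : has_deriv_on I (fun=> c) (fun=> 0).
Proof.
apply/has_derivP => t It e e0; exists 1 => // s _ _.
by rewrite subrr mul0r subr0 normr0 mulr_ge0 ?(ltW e0).
Qed.

Lemma has_deriv_id I : has_deriv_on I id (fun=> 1).
Proof.
apply/has_derivP => t It e e0; exists 1 => // s _ _.
by rewrite mul1r subrr normr0 mulr_ge0 ?(ltW e0).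
Qed.

Lemma has_deriv_add I u v u' v' : has_deriv_on I u u' -> has_deriv_on I v v' ->
  has_deriv_on I (fun t => u t + v t) (fun t => u' t + v' t).
Proof.
move=> hu hv t It; under eq_fun do rewrite opprD addrACA mulrDl.
by apply: cvgD; [exact: hu|exact: hv].
Qed.

Lemma has_deriv_opp I u u' : has_deriv_on I u u' ->
  has_deriv_on I (fun t => - u t) (fun t => - u' t).
Proof.
move=> hu t It; under eq_fun do rewrite -opprD mulNr.
by apply: cvgN; exact: hu.
Qed.

Lemma has_deriv_sub I u v u' v' : has_deriv_on I u u' -> has_deriv_on I v v' ->
  has_deriv_on I (fun t => u t - v t) (fun t => u' t - v' t).
Proof. by move=> hu hv; apply: has_deriv_add => //; exact: has_deriv_opp. Qed.

Lemma within_nbhs I t : within I t^' --> within I (nbhs t).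
Proof.
by move=> A [d /= d0 hd]; exists d => //= s ? ? ?; exact: hd.
Qed.

Lemma has_deriv_mul I u v u' v' : has_deriv_on I u u' -> has_deriv_on I v v' ->
  has_deriv_on I (fun t => u t * v t) (fun t => u' t * v t + u t * v' t).
Proof.
move=> hu hv t It.
have -> : (fun s => (u s * v s - u t * v t) / (s - t)) =
  (fun s => (u s - u t) / (s - t) * v s + u t * ((v s - v t) / (s - t))).
  by apply/funext => s; ring.
apply: cvgD; apply: cvgM; [exact: hu| |exact: cvg_cst|exact: hv].
by move=> B /(has_deriv_cts hv It); exact: (@within_nbhs I t).
Qed.

Lemma has_deriv_scale I c u u' : has_deriv_on I u u' ->
  has_deriv_on I (fun t => c * u t) (fun t => c * u' t).
Proof.
move=> hu; have := has_deriv_mul (has_deriv_cst (I := I) c) hu.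
by apply: eq_has_deriv => // t _; rewrite mul0r add0r.
Qed.

Lemma has_deriv_sqr I u u' : has_deriv_on I u u' ->
  has_deriv_on I (fun t => u t ^+ 2) (fun t => 2 * u t * u' t).
Proof.
move=> hu; have := has_deriv_mul hu hu.
by apply: eq_has_deriv => // t _; ring.
Qed.

Lemma has_deriv_sum (T : finType) I (u u' : T -> R -> R) :
  (forall i, has_deriv_on I (u i) (u' i)) ->
  has_deriv_on I (fun t => \sum_i u i t) (fun t => \sum_i u' i t).
Proof.
move=> hu; suff h : forall r : seq T, has_deriv_on I
    (fun t => \sum_(i <- r) u i t) (fun t => \sum_(i <- r) u' i t) by exact: h.
elim=> [|i r ih].
  by apply: eq_has_deriv (has_deriv_cst 0) => t _; rewrite big_nil.
by apply: eq_has_deriv (has_deriv_add (hu i) ih) => t _; rewrite big_cons.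
Qed.

(** The chain rule; [J] is the set on which the outer function is
    differentiated, and the derivatives may be one-sided. *)
Lemma has_deriv_comp I J u u' f g : (forall t, I t -> J (u t)) ->
  has_deriv_on I u u' -> has_deriv_on J f g ->
  has_deriv_on I (fun t => f (u t)) (fun t => g (u t) * u' t).
Proof.
move=> IJ hu hf; apply/has_derivP => t It e e0.
have k0 : 0 < 1 + `|u' t| by rewrite ltr_pwDl.
have k1 : 0 < 2 * (1 + `|g (u t)|) by rewrite mulr_gt0// ltr_pwDl.
set e1 := e / (2 * (1 + `|u' t|)).
have e10 : 0 < e1 by rewrite divr_gt0// mulr_gt0.
move/has_derivP : (hf) => /(_ _ (IJ _ It) _ e10)[d1 d10 h1].
move: (has_deriv_cts hu) => /cts_onE /(_ t It (d1 / 2)).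
case; first by rewrite divr_gt0.
move=> d2 d20 h2.
set e2 := Num.min 1 (e / (2 * (1 + `|g (u t)|))).
have e20 : 0 < e2 by rewrite lt_min ltr01 divr_gt0.
move/has_derivP : (hu) => /(_ _ It _ e20)[d3 d30 h3].
exists (Num.min d2 d3); first by rewrite lt_min d20.
move=> s Is; rewrite lt_min => /andP[st2 st3].
have us : `|u s - u t| < d1.
  by apply: (le_lt_trans (h2 s Is st2)); rewrite ltr_pdivrMr// mulr2n mulrDr mulr1 ltrDl.
have := h1 _ (IJ _ Is) us.
have {}h3 := h3 s Is st3.
move: h3; set x : R := `|s - t| => h3.
have x0 : 0 <= x by exact: normr_ge0.
have us1 : `|u s - u t| <= (1 + `|u' t|) * x.
  have -> : u s - u t = (u s - u t - u' t * (s - t)) + u' t * (s - t) by ring.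
  apply: (le_trans (ler_normD _ _)); rewrite normrM mulrDl lerD//.
  by apply: (le_trans h3); rewrite ler_wpM2r// ge_min lexx.
move=> h.
have -> : f (u s) - f (u t) - g (u t) * u' t * (s - t) =
  (f (u s) - f (u t) - g (u t) * (u s - u t)) +
  g (u t) * (u s - u t - u' t * (s - t)) by ring.
apply: (le_trans (ler_normD _ _)).
have -> : e * x = e / 2 * x + e / 2 * x by field.
apply: lerD.
- apply: (le_trans h).
  apply: (le_trans (ler_wpM2l (ltW e10) us1)).
  by rewrite mulrA ler_wpM2r// /e1 invfM mulrA mulfVK// gt_eqF.
- rewrite normrM.
  apply: (@le_trans _ _ ((1 + `|g (u t)|) * (e2 * x))).
    by apply: ler_pM => //; rewrite lerDr.
  rewrite mulrA ler_wpM2r//.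
  rewrite -ler_pdivlMl; last by rewrite ltr_pwDl.
  rewrite /e2 ge_min; apply/orP; right.
  by rewrite invfM mulrA mulrC.
Qed.

Lemma is_derive_has_deriv I f g :
  (forall t, I t -> is_derive t (1:R) f (g t)) -> has_deriv_on I f g.
Proof.
move=> h; apply/has_derivP => t It e e0.
have [df <-] := h t It.
have /cvgrPdist_le/(_ e e0) := df.
rewrite near_withinE => -[d /= d0 hd]; exists d => // s Is st.
have [->|nst] := eqVneq s t; first by rewrite !subrr mulr0 subr0 normr0 mulr0.
have := hd (s - t); rewrite /= sub0r normrN => /(_ st).
rewrite subr_eq0 => /(_ nst).
have -> : (s - t)%:A + t = s by rewrite /GRing.scale/= mulr1 subrK.
rewrite -/('D_1 f t) /GRing.scale/= => le0.
move: le0; rewrite /GRing.scale/=.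
have st0 : 0 < `|s - t| by rewrite normr_gt0 subr_eq0.
rewrite -(ler_pM2r st0) -normrM mulrBl mulrAC mulVf ?subr_eq0// mul1r => le.
by rewrite -normrN opprB.
Qed.

End calculus.
Arguments has_deriv_cst {R I} c.
Arguments has_deriv_id {R I}.
Arguments has_deriv_scale {R I} c {u u'} _.

(** * The primitive from 0 and the fundamental theorem of calculus *)

Section integral.
Context (R : realType).
Implicit Types (T : \bar R) (f g u v : R -> R).
Local Notation mu := (@lebesgue_measure R).

(** The primitive of [u] that vanishes at 0. *)
Definition prim u (t : R) : R := \int[mu]_(s in `[0, t]) u s.

Lemma prim0 u : prim u 0 = 0.
Proof. by rewrite /prim set_itv1 Rintegral_set1. Qed.

Lemma Ico0P T (t : R) : Ico0 T t -> forall s, 0 <= s <= t -> Ico0 T s.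
Proof.
move=> [t0 tT] s /andP[s0 st]; split => //.
by apply: le_lt_trans tT; rewrite lee_fin.
Qed.

Lemma cc_sub_Ico0 T (t : R) : Ico0 T t -> `[0, t] `<=` Ico0 T.
Proof. by move=> Tt s /=; rewrite in_itv/=; exact: Ico0P. Qed.

Lemma integrable_cc T u t : cts_on (Ico0 T) u -> Ico0 T t ->
  mu.-integrable `[0, t] (EFin \o u).
Proof.
move=> cu Tt; apply: continuous_compact_integrable; first exact: segment_compact.
apply/cts_onP; exact: cts_onS (cc_sub_Ico0 Tt) cu.
Qed.

Lemma ae_impl (P Q : R -> Prop) : (forall x, P x -> Q x) ->
  {ae mu, forall x, P x} -> {ae mu, forall x, Q x}.
Proof. by move=> PQ; apply: filterS => //; exact: (ae_filter_ringOfSetsType mu). Qed.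

(** If [u] stays within [e] of the constant [c] almost everywhere on ]a, b],
    then the increment of its primitive is within [e (b - a)] of [c (b - a)].
    Both the fundamental theorem of calculus and the Lipschitz continuity of
    primitives of bounded functions follow. *)
Lemma prim_near u (a b c e : R) : 0 <= e -> 0 <= a <= b ->
  mu.-integrable `[0, b] (EFin \o u) ->
  {ae mu, forall r, a < r <= b -> `|u r - c| <= e} ->
  `|prim u b - prim u a - c * (b - a)| <= e * (b - a).
Proof.
move=> e0 /andP[a0 ab] iu uc.
have iu1 : mu.-integrable `]a, b] (EFin \o u).
  apply: integrableS iu => //; apply: subset_itvr; by rewrite bnd_simp.
have muab : mu `]a, b] = (b - a)%:E.
  rewrite lebesgue_measure_itv/= lte_fin.
  have [->|nab] := eqVneq a b; first by rewrite ltxx subrr.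
  by rewrite lt_neqAle nab ab EFinB.
have ic : mu.-integrable `]a, b] (EFin \o (fun=> c)).
  apply/integrableP; split; first exact: measurable_cst.
  rewrite integral_cst//= [X in (_ * X)%E](_ : _ = (b - a)%:E)//.
  by rewrite -EFinM ltry.
have iuc : mu.-integrable `]a, b] (EFin \o (fun r => u r - c)).
  rewrite [X in mu.-integrable _ X](_ : _ = (EFin \o u) \- (EFin \o fun=> c))%E//.
  exact: integrableB.
have -> : prim u b - prim u a - c * (b - a) = \int[mu]_(r in `]a, b]) (u r - c).
  rewrite RintegralB// /prim Rintegral_itvB ?bnd_simp//.
  by rewrite Rintegral_cst//= [X in fine X](_ : _ = (b - a)%:E).
rewrite -lee_fin EFin_normr_Rintegral//.
apply: le_trans (le_abse_integral _ _ _) _ => //.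
  by case/integrableP : iuc.
rewrite EFinM -muab; apply: integral_le_bound => //.
  by case/integrableP : iuc.
Qed.

Lemma cts_has_deriv_prim T u : cts_on (Ico0 T) u ->
  has_deriv_on (Ico0 T) (prim u) u.
Proof.
move=> cu; apply/has_derivP => t Tt e e0.
move/cts_onE : (cu) => /(_ t Tt e e0)[d d0 hd]; exists d => // s Ts st.
have [le_st|/ltW le_ts] := leP s t.
- rewrite -normrN; have -> : - (prim u s - prim u t - u t * (s - t)) =
    prim u t - prim u s - u t * (t - s) by ring.
  have -> : `|s - t| = t - s by rewrite distrC ger0_norm// subr_ge0.
  case: (Ts) => s0 _; apply: prim_near; [exact: ltW|by rewrite s0| |].
    exact: integrable_cc Tt.
  apply: aeW => r /andP[sr rt]; apply: hd.
    by apply: (Ico0P Tt); rewrite rt (le_trans s0 (ltW sr)).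
  rewrite distrC ger0_norm ?subr_ge0//; apply: le_lt_trans st.
  by rewrite distrC ger0_norm ?subr_ge0//  lerB// ltW.
- have -> : `|s - t| = s - t by rewrite ger0_norm// subr_ge0.
  case: (Tt) => t0 _; apply: prim_near; [exact: ltW|by rewrite t0| |].
    exact: integrable_cc Ts.
  apply: aeW => r /andP[sr rt]; apply: hd.
    by apply: (Ico0P Ts); rewrite rt (le_trans t0 (ltW sr)).
  rewrite ger0_norm ?subr_ge0 ?(ltW sr)//; apply: le_lt_trans st.
  by rewrite ger0_norm ?subr_ge0// lerB.
Qed.

(** The primitive of an essentially bounded function is continuous. *)
Lemma prim_lipschitz_cts T u (K : R) :
  (forall t, Ico0 T t -> mu.-integrable `[0, t] (EFin \o u)) ->
  {ae mu, forall r, Ioo0 T r -> `|u r| <= K} -> cts_on (Ico0 T) (prim u).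
Proof.
move=> iu uK; apply/cts_onE => t Tt e e0.
have k0 : 0 < 1 + `|K| by rewrite ltr_pwDl.
have key (a b : R) : Ico0 T b -> 0 <= a <= b ->
    `|prim u b - prim u a| <= (1 + `|K|) * (b - a).
  move=> Tb /andP[a0 ab].
  rewrite -[X in `|X|]subr0 -(mul0r (b - a)).
  apply: prim_near; [exact: ltW|by rewrite a0|exact: iu|].
  apply: ae_impl uK => r hr /andP[ar rb]; rewrite subr0.
  apply: le_trans (hr _) _; last by rewrite ler_wpDl// ler_norm.
  split; first exact: le_lt_trans ar.
  by apply: le_lt_trans Tb.2; rewrite lee_fin.
exists (e / (1 + `|K|)); first by rewrite divr_gt0.
move=> s Ts; rewrite ltr_pdivlMr// mulrC => /ltW le.
have [st|/ltW ts] := leP s t.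
- apply: le_trans le; rewrite distrC (distrC s) (ger0_norm (x := t - s)) ?subr_ge0//.
  by apply: key => //; case: Ts => -> _.
- apply: le_trans le; rewrite (ger0_norm (x := s - t)) ?subr_ge0//.
  by apply: key => //; case: Tt => -> _.
Qed.

(** At an interior point the relative derivative is the usual one. *)
Lemma has_deriv_interior (I : set R) f g (x d : R) : has_deriv_on I f g ->
  0 < d -> (forall s, `|s - x| < d -> I s) -> is_derive x (1:R) f (g x).
Proof.
move=> /has_derivP h d0 dI.
have Ix : I x by apply: dI; rewrite subrr normr0.
have c : h0^-1 *: (f (h0 *: 1 + x) - f x) @[h0 --> 0^'] --> g x.
  apply/cvgrPdist_le => e e0.
  have [d' d'0 hd] := h x Ix e e0.
  rewrite near_withinE; near=> k => k0.
  have kd : `|k| < d by near: k; exists d => //= k /=; rewrite sub0r normrN.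
  have kd' : `|k| < d' by near: k; exists d' => //= k /=; rewrite sub0r normrN.
  have := hd (k + x); rewrite addrK => /(_ (dI _ _) kd').
  rewrite addrK => /(_ kd); rewrite /GRing.scale/= mulr1.
  have k00 : 0 < `|k| by rewrite normr_gt0.
  move=> le; rewrite -(ler_pM2r k00) -normrM mulrBl mulrAC mulVf// mul1r.
  by rewrite -normrN opprB.
split; last exact: cvg_lim c.
by apply/cvg_ex; exists (g x).
Unshelve. all: by end_near. Qed.

Lemma has_deriv_is_derive T f g (x : R) : has_deriv_on (Ico0 T) f g ->
  0 < x -> (x%:E < T)%E -> is_derive x (1:R) f (g x).
Proof.
move=> h x0 xT.
have [y xy yT] : exists2 y, x < y & (y%:E <= T)%E.
  case: T xT {h} => [T|_|//]; last by exists (x + 1); rewrite ?ltrDl ?leey.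
  by rewrite lte_fin => xT; exists T.
apply: (has_deriv_interior (d := Num.min x (y - x)) h).
  by rewrite lt_min x0 subr_gt0.
move=> s; rewrite lt_min !ltr_norml => /andP[/andP[s1 _] /andP[_ s2]]; split; first lra.
by apply: lt_le_trans yT; rewrite lte_fin; lra.
Qed.

(** A function with nonpositive derivative is nonincreasing. *)
Lemma has_deriv_le0 T f g : has_deriv_on (Ico0 T) f g ->
  (forall t, Ico0 T t -> g t <= 0) ->
  forall s t, 0 <= s <= t -> Ico0 T t -> f t <= f s.
Proof.
move=> h g0 s t /andP[s0 st] Tt.
have inn x : x \in `]s, t[ -> 0 < x /\ (x%:E < T)%E.
  rewrite in_itv/= => /andP[sx xt]; split; first exact: le_lt_trans sx.
  by apply: lt_trans Tt.2; rewrite lte_fin.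
apply: (@ler0_derive1_nincr _ f s t) => //.
- by move=> x /inn [x0 xT]; case: (has_deriv_is_derive h x0 xT).
- move=> x /inn [x0 xT]; rewrite derive1E.
  case: (has_deriv_is_derive h x0 xT) => _ ->.
  by apply: g0; split => //; exact: ltW.
- apply/cts_onP; apply: cts_onS (has_deriv_cts h) => x /=.
  by rewrite in_itv/= => /andP[sx xt]; apply: (Ico0P Tt); rewrite xt (le_trans s0).
Qed.

Lemma has_deriv_prim T f g : has_deriv_on (Ico0 T) f g -> cts_on (Ico0 T) g ->
  forall t, Ico0 T t -> prim g t = f t - f 0.
Proof.
move=> h cg t Tt.
have hp := cts_has_deriv_prim cg.
have t0 : (0 : R) <= 0 <= t by rewrite lexx; case: Tt => ->.
have h1 := has_deriv_le0 (has_deriv_sub hp h) _ t0 Tt.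
have h2 := has_deriv_le0 (has_deriv_sub h hp) _ t0 Tt.
have : prim g t - f t = prim g 0 - f 0.
  apply/eqP; rewrite eq_le h1/=; last by move=> ? _; rewrite subrr.
  by rewrite -lerN2 !opprB h2// => ? _; rewrite subrr.
rewrite prim0; lra.
Qed.

Lemma le_prim T u v t : cts_on (Ico0 T) u -> cts_on (Ico0 T) v ->
  (forall s, Ico0 T s -> u s <= v s) -> Ico0 T t -> prim u t <= prim v t.
Proof.
move=> cu cv uv Tt; apply: le_Rintegral => //; [exact: integrable_cc Tt..|].
by move=> s /(cc_sub_Ico0 Tt); exact: uv.
Qed.

End integral.

(** * The coefficient of the linear equation and its fundamental solutions *)

Section elementary.
Context (R : realType).
Implicit Types (I : set R) (u v : R -> R).

Lemma has_deriv_inv I u u' : (forall t, I t -> u t != 0) ->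
  has_deriv_on I u u' ->
  has_deriv_on I (fun t => (u t)^-1) (fun t => - (u' t / u t ^+ 2)).
Proof.
move=> u0 hu.
have hinv : has_deriv_on [set x : R | x != 0] (fun x => x^-1)
    (fun x => - x ^- 2).
  apply: is_derive_has_deriv => t /= t0; apply: DeriveDef.
    by apply: derivableV.
  have [di Di] := @is_derive_id R R t 1.
  rewrite (@deriveV R R id t 1)//.
  by rewrite Di /GRing.scale/= mulr1.
apply: eq_has_deriv (has_deriv_comp u0 hu hinv) => // t _.
by rewrite mulNr mulrC.
Qed.

Lemma has_deriv_powR I u u' (c : R) : (forall t, I t -> 0 < u t) ->
  has_deriv_on I u u' ->
  has_deriv_on I (fun t => u t `^ c) (fun t => c * u t `^ c / u t * u' t).
Proof.
move=> u0 hu.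
have hp : has_deriv_on [set x : R | 0 < x] (fun x => x `^ c)
    (fun x => c * x `^ c / x).
  apply: is_derive_has_deriv => t /= t0.
  apply: is_derive_eq; first exact: is_derive1_powR.
  rewrite powRD; last by rewrite (gt_eqF t0) implybT.
  by rewrite powR_inv1 ?ltW// mulrA.
exact: has_deriv_comp u0 hu hp.
Qed.

Lemma has_deriv_ln I u u' : (forall t, I t -> 0 < u t) ->
  has_deriv_on I u u' -> has_deriv_on I (fun t => ln (u t)) (fun t => u' t / u t).
Proof.
move=> u0 hu.
have hp : has_deriv_on [set x : R | 0 < x] (@ln R) (fun x => x^-1).
  by apply: is_derive_has_deriv => t /= t0; exact: is_derive1_ln.
by apply: eq_has_deriv (has_deriv_comp u0 hu hp) => // t _; rewrite mulrC.
Qed.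

(** A relative derivative on an open half-line is the usual derivative. *)
Lemma derive1_below (c : R) f g : has_deriv_on [set t | t < c] f g ->
  forall t, t < c -> derive1 f t = g t.
Proof.
move=> h t tc; rewrite derive1E.
have [|s ? |_ ->//] := @has_deriv_interior _ _ _ _ t (c - t) h.
  by rewrite subr_gt0.
by rewrite /= ; move: (ler_norm (s - t)); lra.
Qed.

End elementary.
Arguments has_deriv_powR {R I u u'} c _ _.

Section coefficient.
Context (R : realType) (n : nat) (a0 a1 sigma : R).
Hypotheses (hn : (1 <= n)%N) (ha0 : 0 < a0) (ha1 : a1 < 0)
  (hsigma : -1 + 2 / n%:R < sigma).

Local Notation T0 := (T0 n a0 a1 sigma).
Local Notation T1 := (T1 n a0 a1 sigma).
Local Notation A := (A n a0 a1 sigma).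

(** The exponent of the scale function. *)
Definition scale_exp : R := 2 / (n%:R * (1 + sigma)).
(** The constant for which [A t = kappa / (T0 - t) ^+ 2]. *)
Definition kappa : R := scale_exp * (1 - scale_exp).

Let n0 : 0 < n%:R :> R. Proof. by rewrite ltr0n. Qed.

Lemma nsigma_gt2 : 2 < n%:R * (1 + sigma).
Proof.
have : 2 / n%:R < 1 + sigma by move: hsigma; set x := 2 / n%:R; lra.
by rewrite ltr_pdivrMr// mulrC.
Qed.

Lemma sigma1_gt0 : 0 < 1 + sigma.
Proof. by have := nsigma_gt2; rewrite -(pmulr_rgt0 _ n0); lra. Qed.

Lemma scale_exp_gt0 : 0 < scale_exp.
Proof. by rewrite divr_gt0// mulr_gt0// sigma1_gt0. Qed.

Lemma scale_exp_lt1 : scale_exp < 1.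
Proof.
rewrite ltr_pdivrMr ?mul1r; first exact: nsigma_gt2.
by rewrite mulr_gt0// sigma1_gt0.
Qed.

Lemma kappa_gt0 : 0 < kappa.
Proof. by rewrite mulr_gt0 ?scale_exp_gt0// subr_gt0 scale_exp_lt1. Qed.

Lemma T0E : T0 = a0 * scale_exp / `|a1|.
Proof.
rewrite /Defs.T0 /scale_exp ltr0_norm//; field.
rewrite lt_eqF//=; have := sigma1_gt0; have := n0; lra.
Qed.

Lemma T0_gt0 : 0 < T0.
Proof.
rewrite T0E; apply: divr_gt0; last by rewrite normr_gt0 lt_eqF.
by rewrite mulr_gt0 ?scale_exp_gt0.
Qed.

Lemma T1E : T1 = T0%:E.
Proof. by rewrite /Defs.T1 ifT// nmulr_llt0// sigma1_gt0. Qed.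

Lemma scaleE (t : R) : scale n a0 a1 sigma t = a0 * (1 - t / T0) `^ scale_exp.
Proof.
have s1 := sigma1_gt0.
rewrite /scale ifF; last by apply/negbTE; rewrite neq_lt; apply/orP; right; lra.
congr (a0 * _ `^ _).
rewrite /Defs.T0; field; rewrite lt_eqF// !gt_eqF//.
Qed.

Lemma has_deriv_delta (c : R) (I : set R) : has_deriv_on I (fun t => c - t) (fun=> -1).
Proof.
apply: eq_has_deriv (has_deriv_sub (has_deriv_cst c) (has_deriv_id (I := I))) => // t _.
by rewrite sub0r.
Qed.

Lemma has_deriv_tau (I : set R) :
  has_deriv_on I (fun t => 1 - t / T0) (fun=> - T0^-1).
Proof.
have := has_deriv_sub (has_deriv_cst 1) (has_deriv_scale T0^-1 (has_deriv_id (I := I))).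
by apply: eq_has_deriv => t _; [rewrite mulrC|rewrite sub0r mulr1].
Qed.

Lemma tau_gt0 t : t < T0 -> 0 < 1 - t / T0.
Proof. by move=> tT; rewrite subr_gt0 ltr_pdivrMr ?T0_gt0// mul1r. Qed.

Lemma q0E t : t < T0 -> q0 n a0 a1 sigma t = - (2 * scale_exp / (T0 - t)).
Proof.
move=> tT; have d0 : T0 - t != 0 by rewrite subr_eq0 gt_eqF.
have h := has_deriv_sqr (has_deriv_scale a0
  (has_deriv_powR scale_exp tau_gt0 (has_deriv_tau (I := [set t | t < T0])))).
rewrite /q0 (_ : (fun s => scale n a0 a1 sigma s ^+ 2) =
  (fun t : R => (a0 * (1 - t / T0) `^ scale_exp) ^+ 2)); last first.
  by apply/funext => s; rewrite scaleE.
rewrite (derive1_below h tT) scaleE.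
have p0 : (1 - t / T0) `^ scale_exp != 0 by rewrite gt_eqF// powR_gt0// tau_gt0.
have := T0_gt0; move: d0 p0; set p := _ `^ scale_exp; move: T0 => T d0 p0 Tp.
have -> : 1 - t / T = (T - t) / T by field; rewrite gt_eqF.
by field; rewrite p0 d0 (gt_eqF ha0) (gt_eqF Tp).
Qed.

Lemma AE t : t < T0 -> A t = kappa / (T0 - t) ^+ 2.
Proof.
move=> tT; have d0 : T0 - t != 0 by rewrite subr_eq0 gt_eqF.
have h : has_deriv_on [set t | t < T0] (q0 n a0 a1 sigma)
   (fun t => - (2 * scale_exp / (T0 - t) ^+ 2)).
  have hd := has_deriv_opp (has_deriv_scale (2 * scale_exp) (has_deriv_inv _
    (has_deriv_delta T0 (I := [set t | t < T0])))).
  apply: eq_has_deriv (hd _) => [s /= sT|s /= sT|s /= sT].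
  - by rewrite q0E.
  - by rewrite mulN1r opprK.
  - by rewrite subr_eq0 gt_eqF.
rewrite /Defs.A (derive1_below h tT) q0E// /kappa; field; exact: d0.
Qed.

Lemma derive1_AE t : t < T0 -> derive1 A t = 2 * kappa / (T0 - t) ^+ 3.
Proof.
move=> tT; have d0 : T0 - t != 0 by rewrite subr_eq0 gt_eqF.
have h : has_deriv_on [set t | t < T0] A (fun t => 2 * kappa / (T0 - t) ^+ 3).
  have hd := (has_deriv_scale kappa (has_deriv_inv _
    (has_deriv_sqr (has_deriv_delta T0 (I := [set t | t < T0]))))).
  have nz s : s < T0 -> T0 - s != 0 by move=> sT; rewrite subr_eq0 gt_eqF.
  apply: eq_has_deriv (hd _) => [s /= sT|s /= sT|s /= sT].
  - by rewrite AE.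
  - field; exact: nz.
  - by rewrite expf_neq0// nz.
exact: derive1_below h _ tT.
Qed.

(** The linear equation is of Euler type: with tau = 1 - t / T0, it is solved by
    tau^r and tau^(1-r), which are independent unless r = 1/2, and by tau^(1/2)
    and tau^(1/2) ln tau when r = 1/2. *)
Lemma linear_ivp_ex (y0 y1 : R) : exists r, linear_ivp n a0 a1 sigma y0 y1 r.
Proof.
have Tp := T0_gt0.
pose I := Ico0 T1.
have It t : I t -> t < T0 by move=> [_]; rewrite T1E lte_fin.
have I0 t : I t -> T0 - t != 0 by move=> /It tT; rewrite subr_eq0 gt_eqF.
have hd1 := has_deriv_inv I0 (has_deriv_delta T0 (I := I)).
have tauE t : 1 - t / T0 = (T0 - t) / T0 by field; rewrite gt_eqF.
pose u (c t : R) := (1 - t / T0) `^ c.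
have u0 c : u c 0 = 1 by rewrite /u mul0r subr0 powR1.
have hu c : has_deriv_on I (u c) (fun t => - (c * u c t / (T0 - t))).
  have := has_deriv_powR c (fun t It' => tau_gt0 (It t It')) (has_deriv_tau (I := I)).
  apply: eq_has_deriv => // t It'; rewrite -/(u c t) tauE.
  by field; rewrite I0//= gt_eqF.
have hu2 c : has_deriv_on I (fun t => - (c * u c t / (T0 - t)))
    (fun t => c * (c - 1) * u c t / (T0 - t) ^+ 2).
  have := has_deriv_opp (has_deriv_mul (has_deriv_scale c (hu c)) hd1).
  by apply: eq_has_deriv => // t It'; field; exact: I0.
have [r12|r12] := eqVneq scale_exp (1/2).
- pose v (t : R) := ln (1 - t / T0).
  have hv : has_deriv_on I v (fun t => - (1 / (T0 - t))).
    have := has_deriv_ln (fun t It' => tau_gt0 (It t It')) (has_deriv_tau (I := I)).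
    apply: eq_has_deriv => // t It'; rewrite tauE.
    by field; rewrite I0//= gt_eqF.
  have v0 : v 0 = 0 by rewrite /v mul0r subr0 ln1.
  pose al := y0. pose be := - T0 * y1 - y0 / 2.
  have hw := has_deriv_add (has_deriv_cst (I := I) al) (has_deriv_scale be hv).
  have hr := has_deriv_mul (hu (1/2)) hw.
  pose r' t := - ((1/2) * u (1/2) t / (T0 - t)) * (al + be * v t)
    - u (1/2) t * be * (1 / (T0 - t)).
  exists (fun t => u (1/2) t * (al + be * v t)), r'; split.
  + by apply: eq_has_deriv hr => // t _; rewrite /r'; ring.
  + have hi := has_deriv_scale 1 hd1.
    have := has_deriv_sub (has_deriv_mul (hu2 (1/2)) hw)
      (has_deriv_mul (has_deriv_mul (hu (1/2)) (has_deriv_cst be)) hi).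
    apply: eq_has_deriv => t It'; first by rewrite /r'; field; exact: I0.
    rewrite AE ?It// /kappa r12; field; exact: I0.
  + by rewrite u0 v0 /al; ring.
  + rewrite /r' u0 v0 /al /be; field; by rewrite gt_eqF.
- have r120 : 1 - 2 * scale_exp != 0 by apply: contraNneq r12 => h; apply/eqP; lra.
  pose be := (- T0 * y1 - scale_exp * y0) / (1 - 2 * scale_exp).
  pose al := y0 - be.
  have hr := has_deriv_add (has_deriv_scale al (hu scale_exp))
    (has_deriv_scale be (hu (1 - scale_exp))).
  have hr2 := has_deriv_add (has_deriv_scale al (hu2 scale_exp))
    (has_deriv_scale be (hu2 (1 - scale_exp))).
  eexists; eexists; split; [exact: hr| | |].
  + apply: eq_has_deriv hr2 => // t It'.
    rewrite AE ?It// /kappa; field; exact: I0.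
  + by rewrite /= !u0 /al; ring.
  + rewrite /= !u0 /al /be; field; by rewrite gt_eqF.
Qed.

Lemma rho0P : linear_ivp n a0 a1 sigma 1 0 (rho0 n a0 a1 sigma).
Proof.
rewrite /rho0; case: xgetP => // h; have [r hr] := linear_ivp_ex 1 0.
by have := h r.
Qed.

Lemma rho1P : linear_ivp n a0 a1 sigma 0 1 (rho1 n a0 a1 sigma).
Proof.
rewrite /rho1; case: xgetP => // h; have [r hr] := linear_ivp_ex 0 1.
by have := h r.
Qed.

End coefficient.

(** * The Euclidean norm and the nonlinearity *)

Section euclidean_norm.
Context (R : realType) (n : nat).
Implicit Types (u v w : 'rV[R]_n).

(** The Euclidean scalar product. *)
Definition dotp u v : R := \sum_(j < n) u 0 j * v 0 j.

Lemma subvE u v j : (u - v) 0 j = u 0 j - v 0 j.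
Proof. by rewrite !mxE. Qed.

Lemma enorm_ge0 v : 0 <= enorm v. Proof. exact: sqrtr_ge0. Qed.

Lemma sqr_enorm v : enorm v ^+ 2 = \sum_(j < n) v 0 j ^+ 2.
Proof. by rewrite sqr_sqrtr// sumr_ge0// => j _; exact: sqr_ge0. Qed.

Lemma le_enorm v (c : R) : 0 <= c -> \sum_(j < n) v 0 j ^+ 2 <= c ^+ 2 -> enorm v <= c.
Proof. by move=> c0; rewrite -sqr_enorm ler_pXn2r// nnegrE enorm_ge0. Qed.

Lemma normr_le_enorm v j : `|v 0 j| <= enorm v.
Proof.
rewrite -(@ler_pXn2r _ 2)// ?nnegrE ?enorm_ge0// sqr_enorm real_normK ?num_real//.
by rewrite (bigD1 j)//= lerDl sumr_ge0// => i _; exact: sqr_ge0.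
Qed.

Lemma enorm0 : enorm (0 : 'rV[R]_n) = 0.
Proof.
by rewrite /enorm big1 ?sqrtr0// => j _; rewrite mxE expr0n.
Qed.

Lemma enorm_eq0 v : enorm v = 0 -> v = 0.
Proof.
move=> v0; apply/rowP => j; rewrite mxE; apply/eqP.
by rewrite -normr_eq0 eq_le normr_ge0 andbT -v0 normr_le_enorm.
Qed.

Lemma enormZ (c : R) v : enorm (c *: v) = `|c| * enorm v.
Proof.
apply/eqP; rewrite -(@eqrXn2 _ 2)// ?mulr_ge0 ?enorm_ge0//.
rewrite exprMn !sqr_enorm real_normK ?num_real// mulr_sumr.
by apply/eqP; apply: eq_bigr => j _; rewrite mxE exprMn.
Qed.

Lemma enormN v : enorm (- v) = enorm v.
Proof. by rewrite -scaleN1r enormZ normrN1 mul1r. Qed.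

Lemma enorm_distC u v : enorm (u - v) = enorm (v - u).
Proof. by rewrite -enormN opprB. Qed.

Lemma dotp_le u v : dotp u v <= enorm u * enorm v.
Proof.
have [u0|u0] := eqVneq (enorm u) 0.
  rewrite u0 mul0r /dotp big1// => j _.
  by rewrite (enorm_eq0 u0) mxE mul0r.
have [v0|v0] := eqVneq (enorm v) 0.
  rewrite v0 mulr0 /dotp big1// => j _.
  by rewrite (enorm_eq0 v0) mxE mulr0.
have up : 0 < enorm u by rewrite lt_neqAle eq_sym u0 enorm_ge0.
have vp : 0 < enorm v by rewrite lt_neqAle eq_sym v0 enorm_ge0.
have : 0 <= \sum_(j < n) (enorm v * u 0 j - enorm u * v 0 j) ^+ 2.
  by apply: sumr_ge0 => j _; exact: sqr_ge0.
have -> : \sum_(j < n) (enorm v * u 0 j - enorm u * v 0 j) ^+ 2 =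
   enorm v ^+ 2 * enorm u ^+ 2 + enorm u ^+ 2 * enorm v ^+ 2
   - (2 * (enorm u * enorm v)) * dotp u v.
  rewrite {1}(sqr_enorm u) [X in _ + _ * X]sqr_enorm /dotp !mulr_sumr.
  rewrite -big_split/= -sumrB.
  by apply: eq_bigr => j _; ring.
move=> h; rewrite -(ler_pM2l (_ : 0 < 2 * (enorm u * enorm v))).
  by nra.
by rewrite !mulr_gt0.
Qed.

Lemma normr_dotp u v : `|dotp u v| <= enorm u * enorm v.
Proof.
rewrite ler_norml dotp_le andbT lerNl.
have := dotp_le (- u) v; rewrite enormN; apply: le_trans.
by rewrite /dotp -sumrN; apply/le_of_eq/eq_bigr => j _; rewrite mxE mulNr.
Qed.

Lemma enormD u v : enorm (u + v) <= enorm u + enorm v.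
Proof.
rewrite -(@ler_pXn2r _ 2)// ?nnegrE ?addr_ge0 ?enorm_ge0//.
have -> : enorm (u + v) ^+ 2 = enorm u ^+ 2 + 2 * dotp u v + enorm v ^+ 2.
  rewrite !sqr_enorm /dotp mulr_sumr -!big_split/=.
  by apply: eq_bigr => j _; rewrite mxE; ring.
have := dotp_le u v; nra.
Qed.

Lemma enorm_dist u v : `|enorm u - enorm v| <= enorm (u - v).
Proof.
rewrite ler_norml; apply/andP; split.
  rewrite lerNl opprB lerBlDr enorm_distC; apply: le_trans (enormD _ _).
  by rewrite subrK.
by rewrite lerBlDr; apply: le_trans (enormD _ _); rewrite subrK.
Qed.

Lemma enorm_le_sum v : enorm v <= \sum_(j < n) `|v 0 j|.
Proof.
apply: le_enorm; first by apply: sumr_ge0.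
rewrite expr2 mulr_suml; apply: ler_sum => j _.
rewrite -[leLHS]real_normK ?num_real// expr2 ler_wpM2l//.
by rewrite [leRHS](bigD1 j)//= lerDl sumr_ge0.
Qed.

Lemma enorm_const (c : R) : enorm (const_mx c : 'rV[R]_n) = Num.sqrt n%:R * `|c|.
Proof.
apply/eqP; rewrite -(@eqrXn2 _ 2)// ?mulr_ge0 ?enorm_ge0 ?sqrtr_ge0//.
rewrite exprMn sqr_enorm sqr_sqrtr// real_normK ?num_real//.
under eq_bigr do rewrite mxE.
by rewrite big_const_ord iter_addr_0 mulr_natl.
Qed.

End euclidean_norm.

Section nonlinearity.
Context (R : realType) (n : nat).
Implicit Types (y z : 'rV[R]_n) (b : bool).

(** The 1-homogeneous factor of the nonlinearity: [y] itself, or [|y|] in every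
    component. *)
Definition direction b y : 'rV[R]_n := if b then y else const_mx (enorm y).

(** The nonlinearity with radial profile [h]; both choices of [f] are of this
    form for the profile [lambda r^(p-1)]. *)
Definition radial (h : R -> R) b y : 'rV[R]_n := h (enorm y) *: direction b y.

Hypothesis hn : (1 <= n)%N.
Local Notation K := (Num.sqrt n%:R : R).

Lemma sqrt_natr_ge1 : 1 <= K.
Proof. by rewrite -[leLHS]sqrtr1 ler_sqrt// ?ler1n// ltr0n. Qed.

Lemma direction_lip b y z : enorm (direction b y - direction b z) <= K * enorm (y - z).
Proof.
rewrite /direction; case: b.
  by rewrite ler_peMl ?enorm_ge0 ?sqrt_natr_ge1.
have -> : const_mx (enorm y) - const_mx (enorm z) = const_mx (enorm y - enorm z) :> 'rV[R]_n.
  by apply/rowP => j; rewrite !mxE.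
by rewrite enorm_const ler_wpM2l ?sqrtr_ge0// enorm_dist.
Qed.

Lemma direction_le b y : enorm (direction b y) <= K * enorm y.
Proof.
rewrite /direction; case: b; first by rewrite ler_peMl ?enorm_ge0 ?sqrt_natr_ge1.
by rewrite enorm_const ger0_norm ?enorm_ge0.
Qed.

Lemma direction0 b : direction b 0 = 0.
Proof. by rewrite /direction enorm0; case: b. Qed.

Context (lambda p : R).
Hypothesis hp : 1 < p.

(** The radial profile of the power nonlinearities. *)
Definition profile (r : R) : R := lambda * r `^ (p - 1).
(** The profile frozen beyond radius [M]. *)
Definition trunc_profile (M r : R) : R := lambda * (Num.min r M) `^ (p - 1).

Lemma p1_gt0 : 0 < p - 1. Proof. by rewrite subr_gt0. Qed.

Lemma f_vecE : f_vec lambda p = radial profile true :> ('rV[R]_n -> _).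
Proof. by []. Qed.

Lemma f_absE : f_abs lambda p = radial profile false :> ('rV[R]_n -> _).
Proof.
apply/funext => y; rewrite /radial /f_abs /profile /direction; apply/rowP => j.
rewrite !mxE -(mulr_powRB1 (enorm_ge0 y)) ?(lt_trans _ hp)//.
by rewrite -mulrA; congr (_ * _); rewrite mulrC.
Qed.

Lemma trunc_profileE M r : r <= M -> trunc_profile M r = profile r.
Proof. by move=> rM; rewrite /trunc_profile min_l. Qed.

Lemma trunc_profile_le (M r : R) : 0 <= M -> 0 <= r ->
  `|trunc_profile M r| <= `|lambda| * M `^ (p - 1).
Proof.
move=> M0 r0; rewrite /trunc_profile normrM ler_wpM2l// ger0_norm ?powR_ge0//.
by apply: ge0_ler_powR; rewrite ?nnegrE ?(ltW p1_gt0)// ?le_min ?r0//; rewrite ge_min lexx orbT.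
Qed.

(** The function x^p is Lipschitz on [0, M] with constant p M^(p-1). *)
Lemma powR_diff (r s M : R) : 0 <= r -> r <= s -> s <= M ->
  s `^ p - r `^ p <= p * M `^ (p - 1) * (s - r).
Proof.
move=> r0 rs sM; have p0 : 0 < p by exact: lt_trans hp.
have s0 : 0 <= s by exact: le_trans rs.
have M0 : 0 <= M by exact: le_trans sM.
have [->|nrs] := eqVneq r s; first by rewrite !subrr mulr0.
have {nrs} rs' : r < s by rewrite lt_neqAle nrs.
have le_pow (x : R) : 0 <= x -> x <= M -> x `^ (p - 1) <= M `^ (p - 1).
  by move=> x0 xM; rewrite ge0_ler_powR ?nnegrE ?(ltW p1_gt0).
have [r00|rn0] := eqVneq r 0.
  rewrite r00 powR0 ?gt_eqF// !subr0 -(mulr_powRB1 s0 p0) mulrC ler_wpM2r//.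
  apply: le_trans (le_pow _ s0 sM) _; rewrite ler_peMl ?powR_ge0//; exact: ltW.
have rp : 0 < r by rewrite lt_neqAle eq_sym rn0.
have [c|c |] := @MVT R (fun x => x `^ p) (fun x => p * x `^ (p - 1)) r s rs'.
- by rewrite in_itv/= => /andP[rc _]; apply: is_derive1_powR; exact: lt_trans rc.
- apply: derivable_within_continuous => x; rewrite in_itv/= => /andP[rx _].
  have := @is_derive1_powR R p x (lt_le_trans rp rx).
  by case.
- move=> c; rewrite in_itv/= => /andP[rc cs] ->.
  rewrite ler_wpM2r ?subr_ge0// ler_wpM2l// ?(ltW p0)//; apply: le_pow; lra.
Qed.

(** The profile alone need not be Lipschitz at 0 (when p < 2); multiplied by the
    smaller norm it is, by [powR_diff]. *)
Lemma trunc_profile_diff (M : R) y z : 0 <= M -> enorm y <= enorm z ->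
  `|trunc_profile M (enorm z) - trunc_profile M (enorm y)| * enorm y
    <= `|lambda| * (p * M `^ (p - 1)) * enorm (z - y).
Proof.
move=> M0 yz; rewrite /trunc_profile -mulrBr normrM -!mulrA ler_wpM2l//.
have y0 := enorm_ge0 y; have z0 := enorm_ge0 z.
have p0 : 0 < p by exact: lt_trans hp.
have [My|yM] := leP M (enorm y).
  rewrite !min_r ?(le_trans My)// subrr normr0 mul0r !mulr_ge0 ?powR_ge0 ?enorm_ge0//.
  exact: ltW.
set s := Num.min _ _.
have ys : enorm y <= s by rewrite le_min yz ltW.
have sM : s <= M by rewrite ge_min lexx orbT.
have sz : s <= enorm z by rewrite ge_min lexx.
have s0 : 0 <= s by exact: le_trans ys.
rewrite ger0_norm; last first.
  by rewrite subr_ge0 ge0_ler_powR ?nnegrE ?(ltW p1_gt0).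
apply: (@le_trans _ _ (s `^ p - enorm y `^ p)).
  rewrite mulrBl -!(mulr_powRB1 _ p0)// (mulrC (enorm y)) lerB// mulrC ler_wpM2r// powR_ge0//.
apply: le_trans (powR_diff y0 ys sM) _.
rewrite mulrA ler_wpM2l//; first by rewrite mulr_ge0 ?powR_ge0// ltW.
apply: le_trans (enorm_dist z y); apply: le_trans (ler_norm _); lra.
Qed.

(** A Lipschitz constant of the truncated nonlinearity. *)
Definition trunc_lip_const (M : R) : R := K * (`|lambda| * M `^ (p - 1)) * (1 + p).

Lemma trunc_lip_const_ge0 M : 0 <= trunc_lip_const M.
Proof. by rewrite !mulr_ge0 ?powR_ge0 ?sqrtr_ge0//; move: hp; lra. Qed.

Lemma radial_trunc_lip (M : R) b y z : 0 <= M ->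
  enorm (radial (trunc_profile M) b y - radial (trunc_profile M) b z)
    <= trunc_lip_const M * enorm (y - z).
Proof.
move=> M0; wlog zy : y z / enorm z <= enorm y.
  move=> h; have [zy|/ltW yz] := leP (enorm z) (enorm y); first exact: h.
  by rewrite enorm_distC (enorm_distC y); exact: h.
have -> : radial (trunc_profile M) b y - radial (trunc_profile M) b z =
   trunc_profile M (enorm y) *: (direction b y - direction b z)
   + (trunc_profile M (enorm y) - trunc_profile M (enorm z)) *: direction b z.
  by rewrite /radial scalerBr scalerBl addrA subrK.
apply: le_trans (enormD _ _) _; rewrite !enormZ.
apply: (@le_trans _ _ (`|lambda| * M `^ (p - 1) * (K * enorm (y - z)) +
   K * (`|lambda| * (p * M `^ (p - 1)) * enorm (y - z)))).
  apply: lerD.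
    by apply: ler_pM; rewrite ?enorm_ge0 ?trunc_profile_le ?direction_lip ?enorm_ge0.
  apply: le_trans (ler_wpM2l _ (direction_le b z)) _ => //.
  by rewrite mulrCA ler_wpM2l ?sqrtr_ge0// trunc_profile_diff.
by rewrite /trunc_lip_const; apply/le_of_eq; ring.
Qed.

Lemma radial_trunc_le (M : R) b y : 0 <= M ->
  enorm (radial (trunc_profile M) b y) <= K * (`|lambda| * M `^ (p - 1)) * enorm y.
Proof.
move=> M0; rewrite enormZ.
apply: (@le_trans _ _ (`|lambda| * M `^ (p - 1) * (K * enorm y))).
  by apply: ler_pM; rewrite ?enorm_ge0 ?trunc_profile_le ?direction_le ?enorm_ge0.
by apply/le_of_eq; ring.
Qed.

Lemma radial_truncE M b y : enorm y <= M -> radial (trunc_profile M) b y = radial profile b y.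
Proof. by move=> yM; rewrite /radial trunc_profileE. Qed.

End nonlinearity.

Section continuity.
Context (R : realType).

(** Continuity of x^c on the closed half-line, including at 0. *)
Lemma cts_powR (c : R) : 0 < c -> cts_on [set x : R | 0 <= x] (fun x => x `^ c).
Proof.
move=> c0 t /= t0.
have [->|tn0] := eqVneq t 0; last first.
  have tp : 0 < t by rewrite lt_neqAle eq_sym tn0.
  have [dt _] := @is_derive1_powR R c t tp.
  have : {for t, continuous (fun x : R => x `^ c)}.
    by apply: differentiable_continuous; apply/derivable1_diffP.
  by apply: cvg_trans; apply: cvg_app; exact: cvg_within.
rewrite powR0 ?gt_eqF//; apply/cvgrPdist_le => e e0.
rewrite near_withinE; exists (e `^ c^-1) => /=; first exact: powR_gt0.
move=> s /=; rewrite !sub0r !normrN => se s0.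
rewrite ger0_norm ?powR_ge0//.
have -> : e = (e `^ c^-1) `^ c by rewrite -powRrM mulVf ?gt_eqF// powRr1// ltW.
rewrite ge0_ler_powR ?nnegrE ?powR_ge0 ?(ltW c0)//.
by apply: le_trans (ltW se); rewrite ler_norm.
Qed.

Lemma cts_comp_in (I J : set R) (u F : R -> R) : (forall t, I t -> J (u t)) ->
  cts_on J F -> cts_on I u -> cts_on I (fun t => F (u t)).
Proof.
move=> IJ /cts_onE cF /cts_onE cu; apply/cts_onE => t It e e0.
have [d d0 hd] := cF _ (IJ _ It) e e0.
have [d' d'0 hd'] := cu _ It (d / 2) (divr_gt0 d0 (ltr0n _ 2)).
exists d' => // s Is st; apply: hd; first exact: IJ.
by apply: le_lt_trans (hd' s Is st) _; lra.
Qed.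

Context (n : nat).
Implicit Types (Y : R -> 'rV[R]_n).

(** Componentwise continuity relative to [I]. *)
Definition vcts (I : set R) Y := forall j, cts_on I (fun t => Y t 0 j).

Lemma cts_enorm I Y : vcts I Y -> cts_on I (fun t => enorm (Y t)).
Proof.
move=> cY; apply: (cts_comp (F := Num.sqrt)); first exact: sqrt_continuous.
by apply: cts_sum => j; apply: cts_mul; exact: cY.
Qed.

Lemma vcts_radial I Y (h : R -> R) b : cts_on [set x | 0 <= x] h -> vcts I Y ->
  vcts I (fun t => radial h b (Y t)).
Proof.
move=> ch cY j.
have c1 := cts_enorm cY.
have c2 : cts_on I (fun t => h (enorm (Y t))).
  by apply: cts_comp_in ch c1 => t _; exact: enorm_ge0.
have c3 : cts_on I (fun t => direction b (Y t) 0 j).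
  rewrite /direction; case: b; first exact: cY.
  by apply: eq_cts_on c1 => t _; rewrite mxE.
by apply: eq_cts_on (cts_mul c2 c3) => t _; rewrite mxE.
Qed.

Lemma cts_profile (lambda p : R) : 1 < p -> cts_on [set x | 0 <= x] (profile lambda p).
Proof.
by move=> hp; apply: cts_mul; [exact: cts_cst|apply: cts_powR; rewrite subr_gt0].
Qed.

Lemma cts_trunc_profile (lambda p M : R) : 1 < p -> 0 <= M ->
  cts_on [set x | 0 <= x] (trunc_profile lambda p M).
Proof.
move=> hp M0; apply: cts_mul; first exact: cts_cst.
apply: (@cts_comp_in _ [set x | 0 <= x] (fun x => Num.min x M) (fun x => x `^ (p - 1))).
- by move=> t /= t0; rewrite le_min t0.
- by apply: cts_powR; rewrite subr_gt0.
- apply/cts_onE => t _ e e0; exists e => // s _ /ltW st.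
  apply: le_trans st; rewrite /Num.min.
  by case: ltP => h1; case: ltP => h2 //; rewrite ?subrr ?normr0// !ler_norml;
     case: (lerP s t) => h3; rewrite ?(ger0_norm, ler0_norm) ?subr_ge0 ?subr_le0 ?(ltW h3)//; lra.
Qed.

Lemma vcts_bounded T Y t : vcts (Ico0 T) Y -> Ico0 T t ->
  exists2 M : R, 0 <= M & forall s, 0 <= s <= t -> enorm (Y s) <= M.
Proof.
move=> cY Tt.
have c : {within `[0, t], continuous (fun t => enorm (Y t))}.
  by apply/cts_onP; apply: cts_onS (cc_sub_Ico0 Tt) (cts_enorm cY).
have t0 : 0 <= t by case: Tt.
have [c0 _ h] := EVT_max t0 c.
by exists (enorm (Y c0)); [exact: enorm_ge0|move=> s st; apply: h; rewrite in_itv].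
Qed.

End continuity.

(** * From the integral equation to the differential equation; uniqueness *)

Section gronwall.
Context (R : realType).
Implicit Types (T : \bar R) (f g u v : R -> R).

Lemma has_deriv_expR (I : set R) u u' : has_deriv_on I u u' ->
  has_deriv_on I (fun t => expR (u t)) (fun t => expR (u t) * u' t).
Proof.
move=> hu; apply: (has_deriv_comp (J := setT) _ hu) => //.
by apply: is_derive_has_deriv => t _; exact: is_derive_expR.
Qed.

(** Gronwall's inequality, where [B] is a primitive of the growth rate [b]. *)
Lemma gronwall T (E E' B b : R -> R) : has_deriv_on (Ico0 T) E E' ->
  has_deriv_on (Ico0 T) B b -> (forall t, Ico0 T t -> E' t <= b t * E t) ->
  forall t, Ico0 T t -> E t <= E 0 * expR (B t - B 0).
Proof.
move=> hE hB le t Tt.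
have h := has_deriv_mul hE (has_deriv_expR (has_deriv_opp hB)).
have t0 : (0 : R) <= 0 <= t by rewrite lexx; case: Tt => ->.
have := has_deriv_le0 h _ t0 Tt.
rewrite expRD mulrA (expRN (B 0)).
have -> : E 0 * expR (B t) / expR (B 0) = E 0 * expR (- B 0) * expR (B t).
  by rewrite expRN; ring.
move=> h1; have {}h1 := h1 _.
have -> : E t = E t * expR (- B t) * expR (B t).
  by rewrite -mulrA -expRD addNr expR0 mulr1.
rewrite ler_wpM2r ?expR_ge0// (expRN (B 0)); apply: h1 => s Ts.
have -> : E' s * expR (- B s) + E s * (expR (- B s) * - b s) =
  (E' s - b s * E s) * expR (- B s) by ring.
by rewrite mulr_le0_ge0 ?expR_ge0// subr_le0 le.
Qed.

Lemma has_deriv0_cst T f : has_deriv_on (Ico0 T) f (fun=> 0) ->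
  forall t, Ico0 T t -> f t = f 0.
Proof.
move=> h t Tt; have t0 : (0 : R) <= 0 <= t by rewrite lexx; case: Tt => ->.
apply/eqP; rewrite eq_le (has_deriv_le0 h _ t0 Tt)//= -lerN2.
by rewrite (has_deriv_le0 (has_deriv_opp h) _ t0 Tt)// => ? _; rewrite oppr0.
Qed.

Lemma Ico0_next T (t : R) : Ico0 T t -> exists2 t' : R, t < t' & Ico0 T t'.
Proof.
move=> [t0]; case: T => [T|_|//].
  rewrite lte_fin => tT; exists ((t + T) / 2); first lra.
  by split; rewrite ?lte_fin; lra.
by exists (t + 1); [lra|split; [lra|rewrite ltry]].
Qed.

Lemma integrable_mul_cts T u F (t : R) : cts_on (Ico0 T) u -> Ico0 T t ->
  (@lebesgue_measure R).-integrable `[0, t] (EFin \o F) ->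
  (@lebesgue_measure R).-integrable `[0, t] (EFin \o (fun s => u s * F s)).
Proof.
move=> cu Tt iF.
have c : {within `[0, t], continuous u}.
  by apply/cts_onP; exact: cts_onS (cc_sub_Ico0 Tt) cu.
have := @integrableMr _ _ _ (@lebesgue_measure R) `[0, t] _ u (EFin \o F) _ _ iF.
apply.
- by [].
- exact: subspace_continuous_measurable_fun.
- have /compact_bounded[M [_ mrt]] := continuous_compact c (@segment_compact R 0 t).
  by exists M; split; rewrite ?num_real // => ? ? ? ?; exact: mrt.
Qed.

End gronwall.

Section linear.
Context (R : realType) (T0 kap : R) (hT0 : 0 < T0) (hkap : 0 < kap).

(** The coefficient [A] in closed form. *)
Definition coef (t : R) : R := kap / (T0 - t) ^+ 2.

(** [r0] and [r1] are the solutions of the linear equation on [0, T0) with data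
    (1, 0) and (0, 1), with derivatives [r0'] and [r1']. *)
Definition fundamental (r0 r0' r1 r1' : R -> R) : Prop :=
  [/\ has_deriv_on (Ico0 T0%:E) r0 r0' /\
      has_deriv_on (Ico0 T0%:E) r0' (fun t => - (coef t * r0 t)),
      has_deriv_on (Ico0 T0%:E) r1 r1' /\
      has_deriv_on (Ico0 T0%:E) r1' (fun t => - (coef t * r1 t)),
      r0 0 = 1 /\ r0' 0 = 0 & r1 0 = 0 /\ r1' 0 = 1].

Lemma Ico0_lt (t : R) : Ico0 T0%:E t -> 0 < T0 - t.
Proof. by case=> _; rewrite lte_fin subr_gt0. Qed.

Lemma Ico0_T0 : Ico0 T0%:E (0 : R).
Proof. by split; rewrite ?lte_fin. Qed.

Lemma coef_gt0 t : Ico0 T0%:E t -> 0 < coef t.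
Proof. by move=> /Ico0_lt h; rewrite divr_gt0// exprn_gt0. Qed.

Lemma has_deriv_coefV (I : set R) : I `<=` Ico0 T0%:E ->
  has_deriv_on I (fun t => (coef t)^-1) (fun t => - (2 * (T0 - t) / kap)).
Proof.
move=> IT.
have hd : has_deriv_on I (fun t => T0 - t) (fun=> -1).
  by apply: eq_has_deriv (has_deriv_sub (has_deriv_cst T0) has_deriv_id) => // t _; rewrite sub0r.
apply: eq_has_deriv (has_deriv_scale kap^-1 (has_deriv_sqr hd)) => t _.
  by rewrite /coef invf_div mulrC.
by rewrite mulrN1 mulrN mulrC.
Qed.

(** The energy r^2 + r'^2 / A of a solution of the linear equation does not
    increase, because A increases. *)
Lemma linear_bound r r' : has_deriv_on (Ico0 T0%:E) r r' ->
  has_deriv_on (Ico0 T0%:E) r' (fun t => - (coef t * r t)) ->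
  forall t, Ico0 T0%:E t -> `|r t| <= Num.sqrt (r 0 ^+ 2 + (coef 0)^-1 * r' 0 ^+ 2).
Proof.
move=> hr hr' t Tt.
have h := has_deriv_add (has_deriv_sqr hr)
  (has_deriv_mul (has_deriv_coefV (@subset_refl _ _)) (has_deriv_sqr hr')).
have t0 : (0 : R) <= 0 <= t by rewrite lexx; case: Tt => ->.
have le := has_deriv_le0 h _ t0 Tt.
rewrite -[`|r t|]ger0_norm// -sqrtr_sqr ler_sqrt; last first.
  by rewrite addr_ge0 ?sqr_ge0// mulr_ge0 ?sqr_ge0// invr_ge0 ltW// coef_gt0//; exact: Ico0_T0.
rewrite real_normK ?num_real//; apply: le_trans (le _); last first.
  move=> s Ts; have a0 := coef_gt0 Ts; have d0 := Ico0_lt Ts.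
  have -> : 2 * r s * r' s + (- (2 * (T0 - s) / kap) * r' s ^+ 2 +
     (coef s)^-1 * (2 * r' s * - (coef s * r s))) = - (2 * (T0 - s) / kap * r' s ^+ 2).
    by field; rewrite !gt_eqF.
  by rewrite oppr_le0 mulr_ge0 ?sqr_ge0// divr_ge0 ?mulr_ge0 ?ltW.
by rewrite lerDl mulr_ge0 ?sqr_ge0// invr_ge0 ltW// coef_gt0.
Qed.

Context (r0 r0' r1 r1' : R -> R) (fund : fundamental r0 r0' r1 r1').

(** A bound of both fundamental solutions on [0, T0). *)
Definition fund_bound : R := Num.max 1 (Num.sqrt (coef 0)^-1).

Lemma fund_bound_gt0 : 0 < fund_bound. Proof. by rewrite lt_max ltr01. Qed.

Lemma r0_bound t : Ico0 T0%:E t -> `|r0 t| <= fund_bound.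
Proof.
case: fund => -[h h'] _ [e e'] _ Tt; apply: le_trans (linear_bound h h' Tt) _.
by rewrite e e' expr0n mulr0 addr0 expr1n sqrtr1 le_max lexx.
Qed.

Lemma r1_bound t : Ico0 T0%:E t -> `|r1 t| <= fund_bound.
Proof.
case: fund => _ [h h'] _ [e e'] Tt; apply: le_trans (linear_bound h h' Tt) _.
by rewrite e e' expr0n add0r expr1n mulr1 le_max lexx orbT.
Qed.

Lemma wronskian t : Ico0 T0%:E t -> r0 t * r1' t - r0' t * r1 t = 1.
Proof.
case: fund => -[h0 h0'] [h1 h1'] [e0 e0'] [e1 e1'] Tt.
have h := has_deriv_sub (has_deriv_mul h0 h1') (has_deriv_mul h0' h1).
have -> : r0 t * r1' t - r0' t * r1 t = r0 0 * r1' 0 - r0' 0 * r1 0.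
  apply: (has_deriv0_cst (T := T0%:E) (f := fun t => r0 t * r1' t - r0' t * r1 t)) => //.
  by apply: eq_has_deriv h => // s _; ring.
by rewrite e0 e0' e1 e1'; ring.
Qed.

Lemma r0_cts : cts_on (Ico0 T0%:E) r0.
Proof. by case: fund => -[h _] _ _ _; exact: has_deriv_cts h. Qed.
Lemma r1_cts : cts_on (Ico0 T0%:E) r1.
Proof. by case: fund => _ [h _] _ _; exact: has_deriv_cts h. Qed.

Context (n : nat).
Implicit Types (f : 'rV[R]_n -> 'rV[R]_n) (Y V : R -> 'rV[R]_n).

(** The integral operator, for arbitrary fundamental solutions. *)
Definition duhamel f (Y0 Y1 : 'rV[R]_n) Y (t : R) : 'rV[R]_n :=
  \row_j (r0 t * Y0 0 j + r1 t * Y1 0 j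
    - \int[@lebesgue_measure R]_(s in `[0, t])
        ((- (r0 t * r1 s) + r1 t * r0 s) * f (Y s) 0 j)).

(** [Y] is a classical solution on [0, T) of the equation with nonlinearity [f]
    and data [(Y0, Y1)], and [V] is its derivative. *)
Definition is_ode (T : R) f (Y0 Y1 : 'rV[R]_n) Y V : Prop :=
  [/\ forall j, has_deriv_on (Ico0 T%:E) (fun t => Y t 0 j) (fun t => V t 0 j),
      forall j, has_deriv_on (Ico0 T%:E) (fun t => V t 0 j)
        (fun t => - (coef t * Y t 0 j) - f (Y t) 0 j),
      Y 0 = Y0 & V 0 = Y1].

Lemma Ico0_sub (T T' : R) : T <= T' -> Ico0 T%:E `<=` Ico0 T'%:E.
Proof. by move=> TT t [t0]; rewrite lte_fin => tT; split => //; rewrite lte_fin; lra. Qed.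

(** The kernel separates, so the integral in Duhamel's formula is a combination
    of two primitives. *)
Lemma duhamel_int (F : R -> R) (T t : R) : T <= T0 -> Ico0 T%:E t ->
  (@lebesgue_measure R).-integrable `[0, t] (EFin \o F) ->
  \int[@lebesgue_measure R]_(s in `[0, t]) ((- (r0 t * r1 s) + r1 t * r0 s) * F s) =
  - (r0 t * prim (fun s => r1 s * F s) t) + r1 t * prim (fun s => r0 s * F s) t.
Proof.
move=> TT Tt iF; have Tt0 := Ico0_sub TT Tt.
have i0 := integrable_mul_cts r0_cts Tt0 iF.
have i1 := integrable_mul_cts r1_cts Tt0 iF.
have iZ (c : R) (G : R -> R) : (@lebesgue_measure R).-integrable `[0, t] (EFin \o G) ->
   (@lebesgue_measure R).-integrable `[0, t] (EFin \o (fun s => c * G s)).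
  move=> iG; exact: (@integrable_mul_cts _ T%:E (fun=> c) G t (@cts_cst _ _ _) Tt iG).
have -> : (fun s => (- (r0 t * r1 s) + r1 t * r0 s) * F s) =
   (fun s => (- r0 t) * (r1 s * F s) + r1 t * (r0 s * F s)).
  by apply/funext => s; ring.
rewrite RintegralD//; [|exact: iZ..].
by rewrite !RintegralZl// mulNr.
Qed.

Section regular.
Context (T : R) (f : 'rV[R]_n -> 'rV[R]_n) (Y0 Y1 : 'rV[R]_n) (Y : R -> 'rV[R]_n).
Hypothesis TT : T <= T0.
Hypothesis solY : forall t, Ico0 T%:E t -> Y t = duhamel f Y0 Y1 Y t.
Hypothesis iF : forall j t, Ico0 T%:E t ->
  (@lebesgue_measure R).-integrable `[0, t] (EFin \o (fun s => f (Y s) 0 j)).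

Let F j s := f (Y s) 0 j.

Let YE j t : Ico0 T%:E t -> Y t 0 j = r0 t * Y0 0 j + r1 t * Y1 0 j
  + r0 t * prim (fun s => r1 s * F j s) t - r1 t * prim (fun s => r0 s * F j s) t.
Proof.
by move=> Tt; rewrite solY// mxE (duhamel_int TT Tt (iF j Tt)) /F; ring.
Qed.

Let cr0 : cts_on (Ico0 T%:E) r0. Proof. exact: cts_onS (Ico0_sub TT) r0_cts. Qed.
Let cr1 : cts_on (Ico0 T%:E) r1. Proof. exact: cts_onS (Ico0_sub TT) r1_cts. Qed.

(** A solution of the integral equation is continuous as soon as the
    nonlinearity is essentially bounded along it. *)
Lemma sol_cts (K : R) : (forall j, {ae @lebesgue_measure R, forall s, Ioo0 T%:E s ->
    `|f (Y s) 0 j| <= K}) -> vcts (Ico0 T%:E) Y.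
Proof.
move=> Fb j.
have cp r : cts_on (Ico0 T%:E) r -> (forall t, Ico0 T%:E t -> `|r t| <= fund_bound) ->
    cts_on (Ico0 T%:E) (prim (fun s => r s * F j s)).
  move=> cr br; apply: (@prim_lipschitz_cts _ _ _ (fund_bound * K)).
    by move=> t Tt; apply: integrable_mul_cts cr Tt (iF j Tt).
  apply: ae_impl (Fb j) => s h [s0 sT]; rewrite normrM.
  by apply: ler_pM => //; [apply: br; split => //; exact: ltW|exact: h].
have c0 := cp _ cr0 (fun t h => r0_bound (Ico0_sub TT h)).
have c1 := cp _ cr1 (fun t h => r1_bound (Ico0_sub TT h)).
apply: (@eq_cts_on _ _ (fun t => r0 t * Y0 0 j + r1 t * Y1 0 j
  + r0 t * prim (fun s => r1 s * F j s) t - r1 t * prim (fun s => r0 s * F j s) t)).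
  by move=> t Tt; rewrite -YE.
apply: cts_sub; last exact: cts_mul.
by apply: cts_add; [apply: cts_add|]; apply: cts_mul => //; exact: cts_cst.
Qed.

(** Once the nonlinearity is continuous along it, a solution of the integral
    equation is a classical solution, by variation of constants. *)
Lemma sol_ode : vcts (Ico0 T%:E) (fun t => f (Y t)) -> 0 < T ->
  exists V, is_ode T f Y0 Y1 Y V.
Proof.
move=> cF T_gt0; have IS := Ico0_sub TT.
case: (fund) => -[h0 h0'] [h1 h1'] [e0 e0'] [e1 e1'].
have {}h0 := has_derivS IS h0. have {}h0' := has_derivS IS h0'.
have {}h1 := has_derivS IS h1. have {}h1' := has_derivS IS h1'.
pose P1 j := prim (fun s => r1 s * F j s).
pose P0 j := prim (fun s => r0 s * F j s).
have hP1 j : has_deriv_on (Ico0 T%:E) (P1 j) (fun s => r1 s * F j s).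
  by apply: cts_has_deriv_prim; apply: cts_mul => //; exact: cF.
have hP0 j : has_deriv_on (Ico0 T%:E) (P0 j) (fun s => r0 s * F j s).
  by apply: cts_has_deriv_prim; apply: cts_mul => //; exact: cF.
exists (fun t => \row_j (r0' t * Y0 0 j + r1' t * Y1 0 j + r0' t * P1 j t - r1' t * P0 j t)).
have I0 : Ico0 T%:E 0 by split; rewrite ?lte_fin.
split.
- move=> j.
  have := has_deriv_sub (has_deriv_add (has_deriv_add
    (has_deriv_mul h0 (has_deriv_cst (Y0 0 j))) (has_deriv_mul h1 (has_deriv_cst (Y1 0 j))))
    (has_deriv_mul h0 (hP1 j))) (has_deriv_mul h1 (hP0 j)).
  apply: eq_has_deriv => t It; first by rewrite -YE.
  by rewrite mxE; ring.
- move=> j.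
  have := has_deriv_sub (has_deriv_add (has_deriv_add
    (has_deriv_mul h0' (has_deriv_cst (Y0 0 j))) (has_deriv_mul h1' (has_deriv_cst (Y1 0 j))))
    (has_deriv_mul h0' (hP1 j))) (has_deriv_mul h1' (hP0 j)).
  apply: eq_has_deriv => t It; first by rewrite mxE.
  rewrite YE// -/(P1 j t) -/(P0 j t) -[in RHS]/(F j t).
  rewrite -[F j t in RHS]mul1r -(wronskian (IS _ It)); ring.
- by apply/rowP => j; rewrite YE// !prim0 e0 e1; ring.
- by apply/rowP => j; rewrite mxE /P1 /P0 !prim0 e0' e1'; ring.
Qed.

End regular.

(** Classical solutions with the same data coincide.  On a compact subinterval
    both are bounded, so there the nonlinearity may be replaced by a truncated,
    hence Lipschitz, one, and Gronwall's inequality applies to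
    |Y - Z|^2 + |V - W|^2. *)
Lemma ode_unique (T : R) (b : bool) (hn : (1 <= n)%N) (lambda p : R)
    (hp : 1 < p) (Y0 Y1 : 'rV[R]_n) Y V (Z W : R -> 'rV[R]_n) : T <= T0 ->
  is_ode T (radial (profile lambda p) b) Y0 Y1 Y V ->
  is_ode T (radial (profile lambda p) b) Y0 Y1 Z W ->
  forall t, Ico0 T%:E t -> Y t = Z t.
Proof.
move=> TT [hY hV Y00 V00] [hZ hW Z00 W00] t Tt.
have [t' tt' Tt'] := Ico0_next Tt.
have [MY MY0 bY] := vcts_bounded (fun j => has_deriv_cts (hY j)) Tt'.
have [MZ MZ0 bZ] := vcts_bounded (fun j => has_deriv_cts (hZ j)) Tt'.
set f := radial _ _ in hV hW.
pose M := Num.max MY MZ.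
have M0 : 0 <= M by rewrite le_max MY0.
pose L := trunc_lip_const n lambda p M.
have L0 : 0 <= L by exact: trunc_lip_const_ge0.
have t'T : t' < T0 by case: Tt' => _; rewrite lte_fin => ?; exact: lt_le_trans TT.
pose Am := kap / (T0 - t') ^+ 2.
pose k := 2 + Am + L ^+ 2.
have sub : Ico0 t'%:E `<=` Ico0 T%:E.
  by move=> s [s0]; rewrite lte_fin => st; apply: (Ico0P Tt'); rewrite s0 ltW.
pose D (t : R) := \sum_(j < n) ((Y t 0 j - Z t 0 j) ^+ 2 + (V t 0 j - W t 0 j) ^+ 2).
pose dY (t : R) (j : 'I_n) := Y t 0 j - Z t 0 j.
pose dV (t : R) (j : 'I_n) := V t 0 j - W t 0 j.
pose dF (t : R) (j : 'I_n) := f (Y t) 0 j - f (Z t) 0 j.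
have hD : has_deriv_on (Ico0 t'%:E) D (fun t => \sum_(j < n)
   (2 * dY t j * dV t j + 2 * dV t j * (- (coef t * dY t j) - dF t j))).
  apply: has_deriv_sum => j; apply: (has_derivS sub).
  have := has_deriv_add (has_deriv_sqr (has_deriv_sub (hY j) (hZ j)))
    (has_deriv_sqr (has_deriv_sub (hV j) (hW j))).
  apply: eq_has_deriv => // s _; rewrite /dY /dV /dF; ring.
have hB : has_deriv_on (Ico0 t'%:E) (fun t => k * t) (fun=> k).
  by apply: eq_has_deriv (has_deriv_scale k has_deriv_id) => // s _; rewrite mulr1.
have D0 : D 0 = 0.
  by rewrite /D big1// => j _; rewrite Y00 V00 Z00 W00 !subrr expr0n addr0.
have : D t <= D 0 * expR (k * t - k * 0).
  apply: (gronwall hD hB); last by case: Tt => t0 _; split; rewrite ?lte_fin.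
  move=> s Is; have [s0 st'] := Is; rewrite lte_fin in st'.
  have As : 0 <= coef s <= Am.
    have d0 : 0 < T0 - t' by lra.
    have d1 : 0 < T0 - s by lra.
    rewrite divr_ge0 ?sqr_ge0 ?(ltW hkap)//=.
    rewrite ler_pM2l// lef_pV2 ?posrE ?exprn_gt0//.
    by rewrite ler_pXn2r ?nnegrE ?ltW//; lra.
  have dFle : \sum_(j < n) dF s j ^+ 2 <= L ^+ 2 * \sum_(j < n) dY s j ^+ 2.
    have s0t : 0 <= s <= t' by rewrite s0 ltW.
    have fY : f (Y s) = radial (trunc_profile lambda p M) b (Y s).
      by rewrite radial_truncE// le_max bY.
    have fZ : f (Z s) = radial (trunc_profile lambda p M) b (Z s).
      by rewrite radial_truncE// le_max bZ// orbT.
    have := radial_trunc_lip hn lambda hp b (Y s) (Z s) M0.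
    rewrite -fY -fZ -/L => le.
    have -> : \sum_(j < n) dF s j ^+ 2 = enorm (f (Y s) - f (Z s)) ^+ 2.
      by rewrite sqr_enorm; apply: eq_bigr => j _; rewrite subvE.
    have -> : \sum_(j < n) dY s j ^+ 2 = enorm (Y s - Z s) ^+ 2.
      by rewrite sqr_enorm; apply: eq_bigr => j _; rewrite subvE.
    by rewrite -exprMn; apply: lerXn2r le; [exact: enorm_ge0|apply: mulr_ge0 L0 (enorm_ge0 _)].
  apply: (@le_trans _ _ (\sum_(j < n) ((1 + Am) * dY s j ^+ 2
      + (2 + Am) * dV s j ^+ 2 + dF s j ^+ 2))).
    apply: ler_sum => j _; move: As => /andP[A0 A1].
    set x := dY s j; set y := dV s j; set z := dF s j; set q := coef s in A0 A1 *.
    have h1 := sqr_ge0 (x - y). have h2 := sqr_ge0 (y + z). have h3 := sqr_ge0 (x + y).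
    have h4 : q * (x + y) ^+ 2 >= 0 by exact: mulr_ge0.
    have h5 : (Am - q) * (x ^+ 2 + y ^+ 2) >= 0.
      by apply: mulr_ge0; [lra|rewrite addr_ge0 ?sqr_ge0].
    nra.
  rewrite big_split/= big_split/= -!mulr_sumr.
  rewrite /D big_split/= -/(dY s _).
  have y0 : 0 <= \sum_(j < n) dY s j ^+ 2 by apply: sumr_ge0 => j _; exact: sqr_ge0.
  have v0 : 0 <= \sum_(j < n) dV s j ^+ 2 by apply: sumr_ge0 => j _; exact: sqr_ge0.
  have -> : \sum_(i < n) (Y s 0 i - Z s 0 i) ^+ 2 = \sum_(j < n) dY s j ^+ 2 by [].
  have -> : \sum_(i < n) (V s 0 i - W s 0 i) ^+ 2 = \sum_(j < n) dV s j ^+ 2 by [].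
  have L2 := sqr_ge0 L.
  move: dFle y0 v0; rewrite /k.
  set x := \sum_(j < n) dY s j ^+ 2; set y := \sum_(j < n) dV s j ^+ 2.
  move=> h1 h2 h3; have h4 : 0 <= L ^+ 2 * y by exact: mulr_ge0.
  nra.
rewrite D0 mul0r => Dt.
apply/rowP => j; apply/eqP; rewrite -subr_eq0 -sqrf_eq0 eq_le sqr_ge0 andbT.
apply: le_trans Dt; rewrite /D (bigD1 j)//=.
rewrite -addrA lerDl addr_ge0 ?sqr_ge0// sumr_ge0// => i _.
by rewrite addr_ge0 ?sqr_ge0.
Qed.

End linear.

(** * Picard iteration for a globally Lipschitz nonlinearity *)

(** A sequence whose increments decrease geometrically converges at the same
    rate. *)
Lemma geometric_limit (R : realType) (u : nat -> R) (C : R) :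
  (forall k, `|u k.+1 - u k| <= C / 2 ^+ k) ->
  exists y, forall k, `|u k - y| <= 2 * C / 2 ^+ k.
Proof.
move=> h.
have C0 : 0 <= C by have := h 0%N; rewrite expr0 divr1; apply: le_trans.
pose d k := 2 * C / 2 ^+ k.
have d0 k : 0 <= d k by rewrite divr_ge0 ?mulr_ge0// exprn_ge0.
have dS k : C / 2 ^+ k = d k - d k.+1.
  by rewrite /d exprS; field; rewrite expf_neq0.
(* The limit lies between the nondecreasing sequence a and the nonincreasing
   sequence b. *)
pose a k := u k - d k. pose b k := u k + d k.
have aS k : a k <= a k.+1.
  by have := h k; rewrite dS ler_norml /a => /andP[? ?]; lra.
have bS k : b k.+1 <= b k.
  by have := h k; rewrite dS ler_norml /b => /andP[? ?]; lra.
have amono i j : (i <= j)%N -> a i <= a j.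
  by move=> /subnK <-; elim: (j - i)%N => // m ih; rewrite addSn; exact: le_trans ih (aS _).
have bmono i j : (i <= j)%N -> b j <= b i.
  by move=> /subnK <-; elim: (j - i)%N => // m ih; rewrite addSn; exact: le_trans (bS _) ih.
have ab k : a k <= b k by rewrite /a /b; have := d0 k; lra.
have aib i k : a i <= b k.
  apply: le_trans (amono _ _ (leq_maxl i k)) _.
  by apply: le_trans (ab _) _; apply: bmono; exact: leq_maxr.
have ne : [set x | exists k, x = a k] !=set0 by exists (a 0%N), 0%N.
exists (sup [set x | exists k, x = a k]) => k.
have h1 : a k <= sup [set x | exists k, x = a k].
  apply: ub_le_sup; last by exists k.
  by exists (b 0%N) => x [i ->].
have h2 : sup [set x | exists k, x = a k] <= b k.
  by apply: ge_sup => // x [i ->].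
by rewrite -/(d k) ler_norml; move: h1 h2; rewrite /a /b => ? ?; apply/andP; split; lra.
Qed.

Lemma norm_prim_le (R : realType) (T : \bar R) (u v : R -> R) (t : R) :
  cts_on (Ico0 T) u -> cts_on (Ico0 T) v ->
  (forall s, Ico0 T s -> `|u s| <= v s) -> Ico0 T t -> `|prim u t| <= prim v t.
Proof.
move=> cu cv uv Tt; apply: (@le_trans _ _ (prim (fun s => `|u s|) t)).
  by apply: le_normr_Rintegral => //; exact: integrable_cc cu Tt.
by apply: le_prim uv Tt => //; apply: (cts_comp (F := Num.norm)) cu; exact: norm_continuous.
Qed.

Lemma enorm_le_n (R : realType) (n : nat) (v : 'rV[R]_n) (c : R) :
  (forall j, `|v 0 j| <= c) -> enorm v <= n%:R * c.
Proof.
move=> h; apply: le_trans (enorm_le_sum v) _.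
apply: le_trans (ler_sum _ (fun j _ => h j)) _.
by rewrite big_const_ord iter_addr_0 mulr_natl.
Qed.

Section picard.
Context (R : realType) (T0 kap : R) (hT0 : 0 < T0) (hkap : 0 < kap).
Context (r0 r0' r1 r1' : R -> R) (fund : fundamental T0 kap r0 r0' r1 r1').
Context (n : nat) (f : 'rV[R]_n -> 'rV[R]_n) (L : R) (hL : 0 <= L).
Hypothesis f_lip : forall y z, enorm (f y - f z) <= L * enorm (y - z).
Hypothesis f0 : f 0 = 0.
Context (Y0 Y1 : 'rV[R]_n).
Implicit Types (Y Z : R -> 'rV[R]_n).

Local Notation I := (Ico0 T0%:E).
Local Notation K := (fund_bound T0 kap).
Local Notation Phi := (duhamel r0 r1 f Y0 Y1).

(** The weight exp (picard_rate t) makes the integral operator a contraction of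
    ratio 1/2 ([duhamel_contract]). *)
Definition picard_rate : R := 4 * n%:R * K ^+ 2 * L + 1.

Lemma picard_rate_gt0 : 0 < picard_rate.
Proof. rewrite ltr_wpDl// mulr_ge0// mulr_ge0 ?sqr_ge0// mulr_ge0//. Qed.

Lemma vcts_lip Y : vcts I Y -> vcts I (fun t => f (Y t)).
Proof.
move=> cY j; apply/cts_onE => t It e e0.
have k0 : 0 < L * n%:R + 1 by rewrite ltr_wpDl// mulr_ge0.
have c : cts_on I (fun s => \sum_j `|Y s 0 j - Y t 0 j|).
  apply: cts_sum => i; apply: (cts_comp (F := Num.norm)); first exact: norm_continuous.
  by apply: cts_sub; [exact: cY|exact: cts_cst].
have eL : 0 < e / (L + 1) by rewrite divr_gt0// ltr_wpDl.
move/cts_onE : c => /(_ t It _ eL)[d d0 hd].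
exists d => // s Is st.
rewrite -subvE; apply: le_trans (normr_le_enorm _ _) _.
apply: le_trans (f_lip _ _) _.
apply: (@le_trans _ _ (L * (e / (L + 1)))).
  rewrite ler_wpM2l//; apply: le_trans (enorm_le_sum _) _.
  have := hd s Is st; rewrite [X in _ - X]big1 ?subr0; last by move=> i _; rewrite subrr normr0.
  apply: le_trans; rewrite ger0_norm; last by apply: sumr_ge0.
  by apply: ler_sum => i _; rewrite subvE.
by rewrite mulrCA ler_piMr ?(ltW e0)// ler_pdivrMr ?ltr_wpDl// mul1r lerDl.
Qed.

Lemma cts_primF r Y j : cts_on I r -> vcts I Y ->
  cts_on I (prim (fun s => r s * f (Y s) 0 j)).
Proof.
move=> cr cY; have := @cts_has_deriv_prim _ T0%:E (fun s => r s * f (Y s) 0 j).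
move=> h; apply: has_deriv_cts (h _).
by apply: cts_mul => //; exact: vcts_lip.
Qed.

Lemma duhamelE Y t j : vcts I Y -> I t -> Phi Y t 0 j =
  r0 t * Y0 0 j + r1 t * Y1 0 j + r0 t * prim (fun s => r1 s * f (Y s) 0 j) t
   - r1 t * prim (fun s => r0 s * f (Y s) 0 j) t.
Proof.
move=> cY It; rewrite mxE (duhamel_int fund (lexx T0) It (F := fun s => f (Y s) 0 j)).
  by ring.
apply: integrable_cc It; exact: vcts_lip.
Qed.

Lemma vcts_duhamel Y : vcts I Y -> vcts I (Phi Y).
Proof.
move=> cY j; have c0 := r0_cts fund. have c1 := r1_cts fund.
apply: (@eq_cts_on _ _ (fun t => r0 t * Y0 0 j + r1 t * Y1 0 j +
   r0 t * prim (fun s => r1 s * f (Y s) 0 j) t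
   - r1 t * prim (fun s => r0 s * f (Y s) 0 j) t)).
  by move=> t It; rewrite duhamelE.
apply: cts_sub; last by apply: cts_mul => //; exact: cts_primF.
apply: cts_add; last by apply: cts_mul => //; exact: cts_primF.
by apply: cts_add; apply: cts_mul => //; exact: cts_cst.
Qed.

Lemma duhamel_contract Y Z (c : R) : vcts I Y -> vcts I Z -> 0 <= c ->
  (forall s, I s -> enorm (Y s - Z s) <= c * expR (picard_rate * s)) ->
  forall t, I t -> enorm (Phi Y t - Phi Z t) <= c / 2 * expR (picard_rate * t).
Proof.
move=> cY cZ c0 YZ t It.
have b0 := picard_rate_gt0. have K0 : 0 < K := fund_bound_gt0 _ _.
pose g (s : R) := K * L * c * expR (picard_rate * s).
have hg : has_deriv_on I (fun s => K * L * c / picard_rate * expR (picard_rate * s)) g.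
  have hb : has_deriv_on I (fun s => picard_rate * s) (fun=> picard_rate).
    by apply: eq_has_deriv (has_deriv_scale picard_rate has_deriv_id) => // s _; rewrite mulr1.
  apply: eq_has_deriv (has_deriv_scale (K * L * c / picard_rate) (has_deriv_expR hb)) => // s _.
  by rewrite /g; field; rewrite gt_eqF.
(* g is proportional to its own primitive, hence differentiable. *)
have cg : cts_on I g.
  apply: eq_cts_on (cts_mul (@cts_cst _ _ picard_rate) (has_deriv_cts hg)) => s _.
  by rewrite /g; field; rewrite gt_eqF.
have key r j : cts_on I r -> (forall s, I s -> `|r s| <= K) ->
    `|prim (fun s => r s * f (Y s) 0 j) t - prim (fun s => r s * f (Z s) 0 j) t|
     <= K * L * c / picard_rate * expR (picard_rate * t).
  move=> cr br.
  have cFY := cts_mul cr (@vcts_lip Y cY j). have cFZ := cts_mul cr (@vcts_lip Z cZ j).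
  rewrite /prim -RintegralB//; [|exact: integrable_cc It..].
  apply: (@le_trans _ _ (prim g t)).
    apply: norm_prim_le It => //; first exact: cts_sub.
    move=> s Is; rewrite -mulrBr normrM -subvE /g -!mulrA.
    apply: ler_pM => //; first exact: br.
    apply: le_trans (normr_le_enorm _ _) _; apply: le_trans (f_lip _ _) _.
    by rewrite ler_wpM2l// YZ.
  rewrite (has_deriv_prim hg cg It) mulr0 expR0 mulr1 lerBlDr lerDl.
  by rewrite !mulr_ge0 ?invr_ge0// ltW.
apply: (@le_trans _ _ (n%:R * (2 * K * (K * L * c / picard_rate * expR (picard_rate * t))))).
  apply: enorm_le_n => j; rewrite subvE !duhamelE//.
  set A1 := prim _ _; set A0 := prim _ _; set B1 := prim _ _; set B0 := prim _ _.
  have -> : r0 t * Y0 0 j + r1 t * Y1 0 j + r0 t * A1 - r1 t * A0 -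
    (r0 t * Y0 0 j + r1 t * Y1 0 j + r0 t * B1 - r1 t * B0) =
    r0 t * (A1 - B1) - r1 t * (A0 - B0) by ring.
  apply: le_trans (ler_normB _ _) _; rewrite !normrM.
  rewrite [leRHS](_ : _ = K * (K * L * c / picard_rate * expR (picard_rate * t)) +
     K * (K * L * c / picard_rate * expR (picard_rate * t))); last by ring.
  apply: lerD; apply: ler_pM => //.
  - exact: (r0_bound hT0 hkap fund).
  - apply: key; [exact: r1_cts fund|exact: (r1_bound hT0 hkap fund)].
  - exact: (r1_bound hT0 hkap fund).
  - apply: key; [exact: r0_cts fund|exact: (r0_bound hT0 hkap fund)].
have -> : n%:R * (2 * K * (K * L * c / picard_rate * expR (picard_rate * t))) =
   (2 * n%:R * K ^+ 2 * L / picard_rate) * (c * expR (picard_rate * t)) by ring.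
have -> : c / 2 * expR (picard_rate * t) = 2^-1 * (c * expR (picard_rate * t)) by ring.
rewrite ler_wpM2r ?mulr_ge0 ?expR_ge0// ler_pdivrMr// /picard_rate; lra.
Qed.

(** A globally Lipschitz nonlinearity that vanishes at 0 gives a solution on all
    of [0, T0). *)
Lemma picard : exists2 Y, vcts I Y & forall t, I t -> Y t = Phi Y t.
Proof.
have K0 : 0 < K := fund_bound_gt0 _ _. have b0 := picard_rate_gt0.
pose u k := iter k Phi (fun=> 0).
have cu k : vcts I (u k).
  elim: k => [|k ih]; last exact: vcts_duhamel.
  by move=> j; apply: eq_cts_on (@cts_cst _ _ 0) => t _; rewrite mxE.
(* A bound of the first iterate, which is the solution of the linear problem. *)
pose c := n%:R * (K * (enorm Y0 + enorm Y1)).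
have c0 : 0 <= c by rewrite !mulr_ge0 ?addr_ge0 ?enorm_ge0// ltW.
have step k t : I t -> enorm (u k.+1 t - u k t) <= c / 2 ^+ k * expR (picard_rate * t).
  elim: k t => [|k ih] t It.
    rewrite /= subr0 expr0 divr1.
    apply: (@le_trans _ _ c); last first.
      rewrite ler_peMr// -expR0 ler_expR mulr_ge0 ?(ltW b0)//.
      by case: It.
    apply: enorm_le_n => j; rewrite duhamelE//; last exact: (cu 0%N).
    have p0 r : prim (fun s => r s * f 0 0 j) t = 0.
      rewrite f0 (_ : (fun s => _) = fun=> 0).
        by rewrite /prim Rintegral_cst//= mul0r.
      by apply/funext => s; rewrite mxE mulr0.
    rewrite !p0 !mulr0 subr0 addr0 mulrDr.
    apply: le_trans (ler_normD _ _) _; rewrite !normrM.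
    apply: lerD; apply: ler_pM; rewrite ?normr_le_enorm//.
      exact: (r0_bound hT0 hkap fund).
    exact: (r1_bound hT0 hkap fund).
  rewrite exprSr invfM mulrA.
  have ck : 0 <= c / 2 ^+ k by rewrite divr_ge0// exprn_ge0.
  exact: (@duhamel_contract (u k.+1) (u k) _ (cu k.+1) (cu k) ck ih t It).
have lim t : exists y : 'rV[R]_n, I t -> forall k j,
    `|u k t 0 j - y 0 j| <= 2 * (c * expR (picard_rate * t)) / 2 ^+ k.
  have [It|nIt] := pselect (I t); last by exists 0.
  have : forall j, exists y, forall k,
      `|u k t 0 j - y| <= 2 * (c * expR (picard_rate * t)) / 2 ^+ k.
    move=> j; apply: (geometric_limit (u := fun k => u k t 0 j)) => k; rewrite -subvE.
    apply: le_trans (normr_le_enorm _ _) _.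
    by apply: le_trans (step _ _ It) _; rewrite mulrAC.
  move=> /choice[y hy]; exists (\row_j y j) => _ k j; rewrite mxE; exact: hy.
move: lim => /choice[Y hY].
pose cn := n%:R * (2 * c).
have cn0 : 0 <= cn by apply: mulr_ge0 => //; exact: mulr_ge0.
have uY k t : I t -> enorm (u k t - Y t) <= cn / 2 ^+ k * expR (picard_rate * t).
  move=> It; have -> : cn / 2 ^+ k * expR (picard_rate * t) =
     n%:R * (2 * (c * expR (picard_rate * t)) / 2 ^+ k) by rewrite /cn; ring.
  by apply: enorm_le_n => j; rewrite subvE; exact: hY.
have small (e C : R) : 0 < e -> 0 <= C -> exists k, C / 2 ^+ k <= e.
  move=> e0 C0; have := archi_boundP (divr_ge0 C0 (ltW e0)).
  set k := Num.bound _ => hk; exists k.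
  have k2 : k%:R <= 2 ^+ k :> R by rewrite -natrX ler_nat ltnW// ltn_expl.
  rewrite ler_pdivrMr ?exprn_gt0// mulrC -ler_pdivrMr//.
  exact: le_trans (ltW hk) k2.
have cY : vcts I Y.
  move=> j; apply/cts_onE => t It e e0.
  have [k hk] := small (e / 3) (cn * expR (picard_rate * T0)) (divr_gt0 e0 (ltr0n _ 3))
    (mulr_ge0 cn0 (expR_ge0 _)).
  have ub s : I s -> `|u k s 0 j - Y s 0 j| <= e / 3.
    move=> Is; rewrite -subvE; apply: le_trans (normr_le_enorm _ _) _.
    apply: le_trans (uY k s Is) _; apply: le_trans hk.
    rewrite [leRHS]mulrAC ler_wpM2l ?divr_ge0 ?exprn_ge0// ler_expR ler_pM2l//.
    by have := Ico0_lt Is; lra.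
  have := cu k j; move/cts_onE => /(_ t It (e / 3) (divr_gt0 e0 (ltr0n _ 3)))[d d0 hd].
  exists d => // s Is st; have := hd s Is st; have := ub s Is; have := ub t It.
  rewrite !ler_norml => /andP[? ?] /andP[? ?] /andP[? ?]; apply/andP; split; lra.
exists Y => // t It; apply/eqP; rewrite -subr_eq0; apply/eqP/enorm_eq0/eqP.
rewrite eq_le enorm_ge0 andbT; apply/ler_addgt0Pr => e e0; rewrite add0r.
have [k hk] := small e (cn * expR (picard_rate * t)) e0 (mulr_ge0 cn0 (expR_ge0 _)).
apply: le_trans hk.
have -> : Y t - Phi Y t = (Phi (u k) t - Phi Y t) - (u k.+1 t - Y t).
  rewrite -[u k.+1]/(Phi (u k)) opprB; move: (Phi (u k) t) (Phi Y t) (Y t) => a b d.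
  by rewrite [RHS]addrC -[RHS]addrA (addrA (- a)) addNr add0r.
apply: le_trans (enormD _ _) _; rewrite enormN.
have ck : 0 <= cn / 2 ^+ k by rewrite divr_ge0// exprn_ge0.
have h1 := @duhamel_contract (u k) Y _ (cu k) cY ck (fun s => uY k s) t It.
have h2 := uY k.+1 t It.
have -> : cn * expR (picard_rate * t) / 2 ^+ k = cn / 2 ^+ k / 2 * expR (picard_rate * t) +
   cn / 2 ^+ k.+1 * expR (picard_rate * t).
  by rewrite exprS; field; rewrite expf_neq0.
exact: lerD.
Qed.

End picard.

(** * Energy estimates *)

Section energy.
Context (R : realType) (T0 kap : R) (hT0 : 0 < T0) (hkap : 0 < kap).
Context (n : nat) (T : R) (TT : T <= T0) (f : 'rV[R]_n -> 'rV[R]_n).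
Context (Y0 Y1 : 'rV[R]_n) (Y V : R -> 'rV[R]_n).
Hypothesis hode : is_ode T0 kap T f Y0 Y1 Y V.

Local Notation A := (coef T0 kap).
Local Notation I := (Ico0 T%:E).

(** The energy of the linear equation. *)
Definition energy (t : R) : R := enorm (Y t) ^+ 2 + (A t)^-1 * enorm (V t) ^+ 2.

(** The rate (A' / A^2) |V|^2 at which the linear flow loses energy; its
    integral is the square of the third part of the X' norm. *)
Definition dissip (t : R) : R := 2 * (T0 - t) / kap * enorm (V t) ^+ 2.

Let Y_cts : vcts I Y.
Proof. by case: hode => h _ _ _ j; exact: has_deriv_cts (h j). Qed.
Let V_cts : vcts I V.
Proof. by case: hode => _ h _ _ j; exact: has_deriv_cts (h j). Qed.
Let I0 t : I t -> Ico0 T0%:E t.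
Proof. exact: Ico0_sub. Qed.

Lemma energy_ge t : I t -> enorm (Y t) ^+ 2 <= energy t.
Proof.
move=> /I0 /(coef_gt0 hkap) h.
by rewrite lerDl mulr_ge0 ?sqr_ge0// invr_ge0 ltW.
Qed.

Lemma energy_ge0 t : I t -> 0 <= energy t.
Proof. by move=> /energy_ge; apply: le_trans; exact: sqr_ge0. Qed.

Lemma dissip_ge0 t : I t -> 0 <= dissip t.
Proof.
move=> /I0 /Ico0_lt h.
by rewrite mulr_ge0 ?sqr_ge0// divr_ge0 ?mulr_ge0// ltW.
Qed.

Lemma cts_dissip : cts_on I dissip.
Proof.
have cV := cts_enorm V_cts.
apply: cts_mul; last by apply: eq_cts_on (cts_mul cV cV) => t _; rewrite expr2.
apply: cts_mul; last exact: cts_cst.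
apply: cts_mul; first exact: cts_cst.
by apply: cts_sub; [exact: cts_cst|exact: cts_id].
Qed.

Lemma has_deriv_enorm2 : has_deriv_on I (fun t => enorm (Y t) ^+ 2)
  (fun t => 2 * dotp (Y t) (V t)).
Proof.
case: hode => h _ _ _.
apply: eq_has_deriv (has_deriv_sum (fun j => has_deriv_sqr (h j))) => t It.
  by rewrite sqr_enorm.
by rewrite mulr_sumr; apply: eq_bigr => j _; rewrite mulrA.
Qed.

Lemma has_deriv_energy : has_deriv_on I energy
  (fun t => - dissip t - 2 * (A t)^-1 * dotp (V t) (f (Y t))).
Proof.
have hY2 := has_deriv_enorm2.
case: (hode) => h h' _ _.
have hV2 := has_deriv_sum (fun j => has_deriv_sqr (h' j)).
have hA := @has_deriv_coefV R T0 kap I (@Ico0_sub _ _ _ TT).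
apply: eq_has_deriv (has_deriv_add hY2 (has_deriv_mul hA hV2)) => t It.
  by rewrite /energy (sqr_enorm (V t)).
have A0 : A t != 0 by rewrite gt_eqF// (coef_gt0 hkap (I0 It)).
have -> : \sum_i 2 * V t 0 i * (- (A t * Y t 0 i) - f (Y t) 0 i) =
  - (2 * A t) * dotp (Y t) (V t) - 2 * dotp (V t) (f (Y t)).
  rewrite /dotp !mulr_sumr -sumrB; apply: eq_bigr => j _; ring.
rewrite /dissip (sqr_enorm (V t)).
move: (dotp _ _) (dotp _ _) (\sum_i _) => y x z.
have -> : (A t)^-1 * (- (2 * A t) * x - 2 * y) = - 2 * x - 2 * (A t)^-1 * y.
  by field; rewrite A0.
ring.
Qed.

Lemma Ico00 t : I t -> I 0.
Proof. by move=> It; apply: (Ico0P It); rewrite lexx; case: It => ->. Qed.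

(** A bound of the derivative of [E] that includes the dissipation bounds the
    total dissipation as well. *)
Lemma dissip_bound (E E' g : R -> R) : has_deriv_on I E E' -> cts_on I g ->
  (forall t, I t -> E' t <= - dissip t + g t) ->
  forall t, I t -> E t + prim dissip t <= E 0 + prim g t.
Proof.
move=> hE cg le t It.
have h := has_deriv_sub (has_deriv_add hE (cts_has_deriv_prim cts_dissip))
  (cts_has_deriv_prim cg).
have t0 : (0 : R) <= 0 <= t by rewrite lexx; case: It => ->.
have := has_deriv_le0 h _ t0 It; rewrite !prim0 addr0 subr0 lerBlDr; apply => s Is.
by have := le s Is; lra.
Qed.

Section linear_growth.
Context (Lam : R) (hLam : 0 <= Lam).
Hypothesis f_le : forall t, I t -> enorm (f (Y t)) <= Lam * enorm (Y t).

(** The rate [Lam A^(-1/2)] at which a nonlinearity with |f(Y)| <= Lam |Y| can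
    make the energy grow. *)
Definition growth_rate (t : R) : R := Lam / Num.sqrt kap * (T0 - t).
(** The primitive of [growth_rate]. *)
Definition growth (t : R) : R := Lam / Num.sqrt kap * (T0 * t - t ^+ 2 / 2).

Let sk : 0 < Num.sqrt kap. Proof. by rewrite sqrtr_gt0. Qed.

Lemma has_deriv_growth : has_deriv_on I growth growth_rate.
Proof.
apply: has_deriv_scale.
have := has_deriv_sub (has_deriv_scale T0 has_deriv_id)
  (has_deriv_scale 2^-1 (has_deriv_sqr has_deriv_id)).
by move=> h; apply: (eq_has_deriv _ _ (h I)) => t _; field.
Qed.

Lemma growth_rate_ge0 t : I t -> 0 <= growth_rate t.
Proof. by move=> /I0/Ico0_lt h; rewrite mulr_ge0 ?divr_ge0// ltW. Qed.

(** This is Young's inequality: the difference of the two sides is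
    Lam A^(-1/2) (|Y| - A^(-1/2) |V|)^2. *)
Lemma energy_growth t : I t ->
  - (2 * (A t)^-1 * dotp (V t) (f (Y t))) <= growth_rate t * energy t.
Proof.
move=> It; have d0 := Ico0_lt (I0 It).
set s := Num.sqrt kap; set d := T0 - t in d0.
have Ainv : (A t)^-1 = (d / s) ^+ 2.
  by rewrite /coef invf_div expr_div_n sqr_sqrtr// ltW.
have s0 : s != 0 by rewrite gt_eqF.
apply: (@le_trans _ _ (2 * (A t)^-1 * (enorm (V t) * (Lam * enorm (Y t))))).
  rewrite -mulrN; apply: ler_wpM2l.
    by rewrite mulr_ge0// Ainv sqr_ge0.
  apply: le_trans (ler_norm _) _; rewrite normrN.
  apply: le_trans (normr_dotp _ _) _.
  by rewrite ler_wpM2l ?enorm_ge0// f_le.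
rewrite /energy Ainv /growth_rate -/s -/d.
set x := enorm (V t); set y := enorm (Y t).
rewrite -subr_ge0.
have -> : Lam / s * d * (y ^+ 2 + (d / s) ^+ 2 * x ^+ 2)
   - 2 * (d / s) ^+ 2 * (x * (Lam * y)) = Lam * (d / s) * (y - d / s * x) ^+ 2.
  by field.
by rewrite mulr_ge0 ?sqr_ge0// mulr_ge0// divr_ge0// ltW.
Qed.

Lemma energy_gronwall t : I t -> energy t <= energy 0 * expR (growth t).
Proof.
move=> It; have := gronwall has_deriv_energy has_deriv_growth _ It.
have -> : growth 0 = 0 by rewrite /growth; ring.
rewrite subr0; apply => s Is.
have := energy_growth Is; have := dissip_ge0 Is; lra.
Qed.

Lemma growth_homo s t : 0 <= s <= t -> I t -> growth s <= growth t.
Proof.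
move=> st It; rewrite -lerN2.
apply: (has_deriv_le0 (has_deriv_opp has_deriv_growth) _ st It) => r Ir.
by rewrite oppr_le0 growth_rate_ge0.
Qed.

(** The common constant 9 is a crude bound, chosen to be a square: the energy
    grows at most by the factor e <= 4, and the dissipated energy is then at
    most 5 E(0). *)
Lemma energy_small t : I t -> growth t <= 1 ->
  energy t <= 9 * energy 0 /\ prim dissip t <= 9 * energy 0.
Proof.
move=> It W1; have I00 := Ico00 It; have E0 := energy_ge0 I00.
(* From exp (-1/2) >= 1/2 it follows that exp 1 <= 4. *)
have e4 : expR 1 <= 4 :> R.
  have h : 2^-1 <= expR (- 2^-1) :> R.
    by have := expR_ge1Dx (- 2^-1 : R); lra.
  have {h} h : expR (2^-1) <= 2 :> R.
    move: h; rewrite expRN lef_pV2 ?posrE ?expR_gt0//.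
  have -> : 1 = 2^-1 + 2^-1 :> R by field.
  rewrite expRD; have := expR_ge0 (2^-1 : R); nra.
have Ebd s : 0 <= s <= t -> energy s <= 4 * energy 0.
  move=> st; have Is := Ico0P It st.
  apply: le_trans (energy_gronwall Is) _.
  rewrite mulrC ler_wpM2r//; apply: le_trans e4; rewrite ler_expR.
  exact: le_trans (growth_homo st It) W1.
have t0 : 0 <= t by case: It.
split; first by have := Ebd t; rewrite lexx t0 => /(_ isT); lra.
have cw : cts_on I growth_rate.
  apply: cts_mul; first exact: cts_cst.
  by apply: cts_sub; [exact: cts_cst|exact: cts_id].
have cE := has_deriv_cts has_deriv_energy.
have := dissip_bound has_deriv_energy (cts_mul cw cE) _ It.
move=> h; have {h} h1 : energy t + prim dissip t <=
    energy 0 + prim (fun s => growth_rate s * energy s) t.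
  by apply: h => s Is; have := energy_growth Is; lra.
have h2 : prim (fun s => growth_rate s * energy s) t <= 4 * energy 0.
  apply: (@le_trans _ _ (4 * energy 0 * growth t)); last first.
    by rewrite ler_piMr// mulr_ge0.
  have -> : 4 * energy 0 * growth t = prim (fun s => 4 * energy 0 * growth_rate s) t.
    rewrite (has_deriv_prim (has_deriv_scale (4 * energy 0) has_deriv_growth) _ It).
      by rewrite /growth; ring.
    by apply: cts_mul => //; exact: cts_cst.
  apply: le_Rintegral => //.
  - exact: integrable_cc (cts_mul cw cE) It.
  - exact: integrable_cc (cts_mul (@cts_cst _ _ _) cw) It.
  - move=> s; rewrite /= in_itv/= => st; rewrite mulrC ler_wpM2r ?Ebd//.
    exact: growth_rate_ge0 (Ico0P It st).
have := energy_ge0 It; lra.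
Qed.

End linear_growth.

Section defocusing.
Context (h : R -> R).
Hypothesis h_cts : cts_on [set x | 0 <= x] h.
Hypothesis h_ge0 : forall x, 0 <= x -> 0 <= h x.
Hypothesis fE : f = radial h true.

(** The potential energy of the profile [h] as a function of |Y|^2, up to the
    factor 2: the gradient of [potential (|y|^2)] is [2 h(|y|) y]. *)
Definition potential (s : R) : R := prim (fun u => h (Num.sqrt u)) s.

Let csq : cts_on (Ico0 +oo%E) (fun u => h (Num.sqrt u)).
Proof.
apply: cts_comp_in h_cts _; first by move=> u _; exact: sqrtr_ge0.
by apply: (cts_comp (F := Num.sqrt)) (@cts_id _ _); exact: sqrt_continuous.
Qed.

Lemma potential_ge0 s : 0 <= s -> 0 <= potential s.
Proof.
by move=> s0; apply: Rintegral_ge0 => u _; apply: h_ge0; exact: sqrtr_ge0.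
Qed.

(** For a nonnegative profile the energy augmented by the potential energy
    divided by A is dissipated at least at the linear rate. *)
Lemma defocusing_bound t : I t ->
  energy t <= energy 0 + (A 0)^-1 * potential (enorm (Y 0) ^+ 2) /\
  prim dissip t <= energy 0 + (A 0)^-1 * potential (enorm (Y 0) ^+ 2).
Proof.
move=> It.
have hP : has_deriv_on I (fun t => potential (enorm (Y t) ^+ 2))
   (fun t => h (Num.sqrt (enorm (Y t) ^+ 2)) * (2 * dotp (Y t) (V t))).
  apply: has_deriv_comp has_deriv_enorm2 (cts_has_deriv_prim csq) => s _.
  by split; rewrite ?sqr_ge0// ltry.
have hA := @has_deriv_coefV R T0 kap I (@Ico0_sub _ _ _ TT).
have hG := has_deriv_add has_deriv_energy (has_deriv_mul hA hP).
have AV s : I s -> 0 <= (A s)^-1 by move=> /I0 Is; rewrite invr_ge0 ltW// coef_gt0.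
have P0 s : 0 <= potential (enorm (Y s) ^+ 2) by rewrite potential_ge0// sqr_ge0.
have dle := dissip_bound hG (@cts_cst _ _ 0) _ It.
have {}dle : energy t + (A t)^-1 * potential (enorm (Y t) ^+ 2) + prim dissip t <=
   energy 0 + (A 0)^-1 * potential (enorm (Y 0) ^+ 2).
  apply: le_trans (dle _) _; last by rewrite /prim Rintegral_cst//= mul0r addr0.
  move=> s Is.
  have -> : dotp (V s) (f (Y s)) = h (enorm (Y s)) * dotp (Y s) (V s).
    by rewrite fE /radial /direction /dotp mulr_sumr; apply: eq_bigr => j _; rewrite mxE; ring.
  rewrite sqrtr_sqr ger0_norm ?enorm_ge0//.
  have : 0 <= 2 * (T0 - s) / kap * potential (enorm (Y s) ^+ 2).
    have d0 := Ico0_lt (I0 Is).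
    by rewrite mulr_ge0// divr_ge0 ?mulr_ge0// ltW.
  move: (dotp _ _) (2 * (T0 - s) / kap) (h _) (potential _) (A s)^-1 => x q k P a; nra.
have h1 : 0 <= (A t)^-1 * potential (enorm (Y t) ^+ 2) by rewrite mulr_ge0// AV.
have h2 : 0 <= prim dissip t.
  by apply: Rintegral_ge0 => s; rewrite /= in_itv/= => /(Ico0P It) /dissip_ge0.
move: dle h1 h2 (energy_ge0 It).
move: (energy t) (prim dissip t) ((A t)^-1 * _) (energy 0 + _) => a b c d.
by move=> h0 h1 h2 h3; split; [apply: le_trans h0|apply: le_trans h0]; lra.
Qed.

End defocusing.

End energy.

(** * Lebesgue norms and weak derivatives on a bounded interval *)

Section norms.
Context (R : realType).
Local Notation mu := (@lebesgue_measure R).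

Lemma lebesgue_setT_gt0 : (0 < mu [set: R])%E.
Proof.
apply: (@lt_le_trans _ _ (mu `[0, 1])).
  by rewrite lebesgue_measure_itv/= lte_fin ltr01 sube0 lte_fin.
by apply: le_measure; rewrite ?inE.
Qed.

Lemma Ioo0E (T : R) : Ioo0 T%:E = `]0, T[%classic.
Proof.
by apply/seteqP; split => x; rewrite /Ioo0 /= in_itv/= lte_fin;
  [move=> [-> ->]|move=> /andP[-> ->]].
Qed.

Lemma measurable_Ioo0 (T : R) : measurable (Ioo0 T%:E).
Proof. by rewrite Ioo0E. Qed.

Lemma Lnorm_oo_le (T : R) (u : R -> R) (c : R) : 0 <= c ->
  (forall t, Ioo0 T%:E t -> `|u t| <= c) -> (Lnorm_Ioo T%:E +oo u <= c%:E)%E.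
Proof.
move=> c0 uc; rewrite /Lnorm_Ioo unlock lebesgue_setT_gt0.
apply/ess_supP; apply: aeW => t; rewrite /= lee_fin patchE.
by case: ifPn => [/set_mem/uc//|_]; rewrite normr0.
Qed.

Lemma Lnorm_oo_lty (T : R) (u : R -> R) : (Lnorm_Ioo T%:E +oo u < +oo)%E ->
  exists K, {ae mu, forall t, Ioo0 T%:E t -> `|u t| <= K}.
Proof.
rewrite /Lnorm_Ioo unlock lebesgue_setT_gt0.
move=> /(@ess_supr_bounded _ _ _ mu (fun t => `|(u \_ (Ioo0 T%:E)) t|))[K hK].
exists K; apply: ae_impl hK => t + Tt.
by rewrite patchE mem_set.
Qed.

(** The L^2 norm on ]0, T[ is a monotone limit of the norms on the compact
    intervals [0, T - T/(k+1)]. *)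
Lemma Lnorm_2_le (T : R) (u g : R -> R) (c : R) : 0 < T -> 0 <= c ->
  cts_on (Ico0 T%:E) g -> (forall t, Ico0 T%:E t -> 0 <= g t) ->
  (forall t, Ioo0 T%:E t -> u t ^+ 2 = g t) ->
  (forall t, Ico0 T%:E t -> prim g t <= c ^+ 2) ->
  (Lnorm_Ioo T%:E 2%:E u <= c%:E)%E.
Proof.
move=> T0 c0 cg g0 ug gc; rewrite /Lnorm_Ioo unlock.
have -> : (c%:E = ((c ^+ 2)%:E `^ 2^-1))%E.
  by rewrite poweR_EFin powR12_sqrt ?sqr_ge0// sqrtr_sqr ger0_norm.
apply: gt0_ler_poweR => //; rewrite ?in_itv/= ?leey ?andbT//.
- by apply: integral_ge0 => x _; rewrite lee_fin powR_ge0.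
- by rewrite lee_fin sqr_ge0.
have -> : (\int[mu]_x (`|(EFin \o u \_ (Ioo0 T%:E)) x| `^ 2) =
  \int[mu]_(x in Ioo0 T%:E) (g x)%:E)%E.
  rewrite [RHS]integral_mkcond; apply: eq_integral => x _; rewrite /= !patchE.
  case: ifPn => [/set_mem Tx|_].
    by rewrite powR_mulrn// real_normK ?num_real// ug.
  by rewrite powR_mulrn// normr0 expr0n.
pose t k : R := T - T / k.+1%:R.
pose F k : set R := `[0, t k]%classic.
have Tt k : Ico0 T%:E (t k).
  split; first by rewrite subr_ge0 ler_pdivrMr// ler_peMr ?ler1n// ltW.
  by rewrite lte_fin ltrBlDr ltrDl divr_gt0.
have mF k : measurable (F k) by exact: measurable_itv.
have FI k : F k `<=` Ico0 T%:E by exact: cc_sub_Ico0.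
have mg k : measurable_fun (F k) (EFin \o g).
  apply/measurable_EFinP; apply: subspace_continuous_measurable_fun => //.
  by apply/cts_onP; exact: cts_onS (FI k) cg.
have g0' k x : F k x -> (0 <= (EFin \o g) x)%E.
  by move=> /FI /g0; rewrite lee_fin.
have ndF : nondecreasing_seq F.
  apply/nondecreasing_seqP => k; rewrite subsetEset => x; rewrite /F /= !in_itv/= => /andP[-> xt].
  apply: le_trans xt _; rewrite lerB// ler_pM2l// lef_pV2 ?posrE// ler_nat//.
have cvgF : (\int[mu]_(x in F i) (g x)%:E)%E @[i --> \oo] -->
    (\int[mu]_(x in \bigcup_i F i) (g x)%:E)%E.
  exact: (@ge0_nondecreasing_set_cvg_integral _ (measurableTypeR R) R F (EFin \o g) mu
    ndF mF mg g0').
have UF : \bigcup_i F i = Ico0 T%:E.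
  apply/seteqP; split => [x [k _ /FI//]|x [x0]]; rewrite lte_fin => xT.
  have Tx : 0 < T - x by rewrite subr_gt0.
  have := archi_boundP (divr_ge0 (ltW T0) (ltW Tx)).
  set k := Num.bound _ => hk; exists k => //; rewrite /F/= in_itv/= x0 /t/=.
  have k1 : T / (T - x) <= k.+1%:R by apply: ltW; apply: lt_trans hk _; rewrite ltr_nat.
  rewrite lerBrDr -lerBrDl ler_pdivrMr// mulrC -ler_pdivrMr//.
apply: (@le_trans _ _ (\int[mu]_(x in \bigcup_i F i) (g x)%:E)%E).
  apply: ge0_subset_integral; first exact: measurable_Ioo0.
  - by apply: bigcupT_measurable => k; exact: mF.
  - have -> : \bigcup_i F i = `[0, T[%classic.
      by rewrite UF; apply/seteqP; split => x; rewrite /Ico0 /= in_itv/= lte_fin;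
  [move=> [-> ->]|move=> /andP[-> ->]].
    apply/measurable_EFinP; apply: subspace_continuous_measurable_fun => //.
    apply/cts_onP; apply: cts_onS cg => x /=; rewrite in_itv/= => /andP[? ?].
    by split; rewrite ?lte_fin.
  - by move=> x; rewrite UF => /g0; rewrite lee_fin.
  - by rewrite UF => x [x0 xT]; split => //; exact: ltW.
rewrite -(cvg_lim _ cvgF)//; apply: lime_le; first by apply/cvg_ex; eexists; exact: cvgF.
apply: nearW => k.
have ik := integrable_cc cg (Tt k).
rewrite -[leLHS]fineK; last exact: integrable_fin_num ik.
by rewrite lee_fin; exact: gc.
Qed.

Lemma measurable_cts (T : R) (u : R -> R) : cts_on (Ico0 T%:E) u ->
  measurable_fun (Ioo0 T%:E) u.
Proof.
move=> cu; apply: subspace_continuous_measurable_fun; first exact: measurable_Ioo0.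
by apply/cts_onP; apply: cts_onS cu => x [x0 xT]; split => //; exact: ltW.
Qed.

Lemma loc_integrable_cts (T : R) (u : R -> R) : cts_on (Ico0 T%:E) u ->
  loc_integrable T%:E u.
Proof.
move=> cu; split; first exact: measurable_cts.
move=> a b a0 bT; apply: continuous_compact_integrable; first exact: segment_compact.
apply/cts_onP; apply: cts_onS cu => x /=; rewrite in_itv/= => /andP[ax xb]; split.
  exact: le_trans (ltW a0) ax.
by apply: le_lt_trans bT; rewrite lee_fin.
Qed.

(** An essentially bounded measurable function on ]0, T[ is integrable on [0, t]
    for t < T; the point 0 is negligible. *)
Lemma bounded_integrable (T : R) (F : R -> R) (K t : R) :
  measurable_fun (Ioo0 T%:E) F -> {ae mu, forall s, Ioo0 T%:E s -> `|F s| <= K} ->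
  Ico0 T%:E t -> mu.-integrable `[0, t] (EFin \o F).
Proof.
move=> mF bF Tt.
have sub : `]0, t]%classic `<=` Ioo0 T%:E.
  move=> x /=; rewrite in_itv/= => /andP[x0 xt]; split => //.
  by apply: le_lt_trans Tt.2; rewrite lee_fin.
have m1 : measurable_fun `]0, t] F by apply: measurable_funS mF => //; exact: measurable_Ioo0.
have m2 : measurable_fun `[0, t] F by apply/measurable_fun_itv_obnd_cbndP.
apply/integrableP; split; first exact/measurable_EFinP.
rewrite -integral_itv_obnd_cbnd; last first.
  by apply/measurable_EFinP; apply: measurableT_comp => //.
apply: le_lt_trans (integral_le_bound `|K|%:E _ _ _ _) _ => //.
- exact/measurable_EFinP.
- apply: ae_impl bF => s h /sub /h; rewrite lee_fin => /le_trans; apply.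
  exact: ler_norm.
have t0 : 0 <= t by case: Tt.
rewrite -[X in (_ * X)%E]/(mu `]0, t]) lebesgue_measure_itv/= lte_fin.
by case: ifPn => _; rewrite ?mule0 ?ltry// -EFinD -EFinM ltry.
Qed.

Lemma test_function_derive (T : \bar R) (phi : R -> R) : test_function T phi ->
  has_deriv_on setT phi (derive1 phi) /\ cts_on setT (derive1 phi).
Proof.
move=> [sm _].
have hd (g : R -> R) : (forall x, derivable g x 1) -> has_deriv_on setT g (derive1 g).
  by move=> dg; apply: is_derive_has_deriv => t _; apply: DeriveDef; [exact: dg|rewrite derive1E].
split; first by apply: hd => x; exact: (sm 0%N).
by apply: has_deriv_cts (hd _ _) => x; exact: (sm 1%N).
Qed.

(** A classical derivative is a weak derivative: this is integration by parts
    against a test function whose support lies in [0, b1] with b1 < T. *)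
Lemma weak_deriv_comp (T : R) (y v phi : R -> R) : 0 < T ->
  has_deriv_on (Ico0 T%:E) y v -> cts_on (Ico0 T%:E) v -> test_function T%:E phi ->
  \int[mu]_(t in Ioo0 T%:E) (y t * derive1 phi t) =
          - \int[mu]_(t in Ioo0 T%:E) (v t * phi t).
Proof.
move=> T0 hy cv tphi; have [hphi cphi'] := test_function_derive tphi.
case: tphi => _ [a [b [a0 bT phi0]]].
(* The support may be empty with b < 0, hence the maximum with 0. *)
have [b1 bb1 Tb1] : exists2 b1 : R, Num.max b 0 < b1 & Ico0 T%:E b1.
  apply: Ico0_next; split; first by rewrite le_max lexx orbT.
  by rewrite lte_fin gt_max T0 -lte_fin bT.
move: bb1; rewrite gt_max => /andP[bb1 b10].
have phi'0 x : x < a \/ b < x -> derive1 phi x = 0.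
  move=> xab; rewrite derive1E.
  have h : has_deriv_on [set x | x < a \/ b < x] phi (fun=> 0).
    apply: eq_has_deriv (has_deriv_cst 0) => // s /= sab; rewrite phi0//.
    by apply/negP => /andP[? ?]; case: sab; lra.
  case: xab => [xa|bx].
  - have [|s|_ ->//] := @has_deriv_interior _ _ _ _ x (a - x) h; first by rewrite subr_gt0.
    by move=> hs; left; move: hs (ler_norm (s - x)); lra.
  - have [|s|_ ->//] := @has_deriv_interior _ _ _ _ x (x - b) h; first by rewrite subr_gt0.
    by rewrite distrC => hs; right; move: hs (ler_norm (x - s)); lra.
have phi0' x : x < a \/ b < x -> phi x = 0.
  by move=> xab; rewrite phi0//; apply/negP => /andP[? ?]; case: xab; lra.
have red (u w : R -> R) : (forall x, x < a \/ b < x -> w x = 0) ->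
    \int[mu]_(t in Ioo0 T%:E) (u t * w t) = prim (fun t => u t * w t) b1.
  move=> w0; rewrite /prim Rintegral_mkcond [RHS]Rintegral_mkcond.
  apply: eq_Rintegral => x _; rewrite !patchE.
  have z0 : w x = 0 -> (if x \in Ioo0 T%:E then u x * w x else point) =
    (if x \in `[0, b1]%classic then u x * w x else point).
    by move=> ->; rewrite mulr0; case: ifPn => _; case: ifPn.
  have [xa|ax] := ltP (x : R) a; first by apply: z0; apply: w0; left.
  have [bx|xb] := ltP b (x : R); first by apply: z0; apply: w0; right.
  rewrite !mem_set//=.
    by rewrite in_itv/= (le_trans (ltW a0) ax) (le_trans xb (ltW bb1)).
  split; first exact: lt_le_trans ax.
  by apply: le_lt_trans bT; rewrite lee_fin.
have I_sub (g : R -> R) : cts_on setT g -> cts_on (Ico0 T%:E) g by apply: cts_onS.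
have cy := has_deriv_cts hy. have cphi := I_sub _ (has_deriv_cts hphi).
have hm := has_deriv_mul hy (has_derivS (@subsetT _ (Ico0 T%:E)) hphi).
rewrite (red _ _ phi'0) (red _ _ phi0').
have cm1 := cts_mul cv cphi. have cm2 := cts_mul cy (I_sub _ cphi').
have := has_deriv_prim hm (cts_add cm1 cm2) Tb1.
rewrite (phi0' b1); last by right.
rewrite (phi0' 0); last by left.
rewrite !mulr0 subrr /prim RintegralD//; [|exact: integrable_cc Tb1..].
by move=> /eqP; rewrite addrC addr_eq0 => /eqP.
Qed.

End norms.

(** * The Cauchy problem *)

Lemma is_odeS (R : realType) (T0 kap : R) (n : nat) (T T' : R) f (Y0 Y1 : 'rV[R]_n) Y V :
  T <= T' -> is_ode T0 kap T' f Y0 Y1 Y V -> is_ode T0 kap T f Y0 Y1 Y V.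
Proof.
move=> TT [h1 h2 h3 h4]; split => // j; exact: has_derivS (Ico0_sub TT) _.
Qed.

Section measurability.
Context (R : realType) (n : nat).
Implicit Types (Y : R -> 'rV[R]_n).

Lemma measurable_enorm (D : set R) Y : measurable D ->
  (forall j, measurable_fun D (fun t => Y t 0 j)) ->
  measurable_fun D (fun t => enorm (Y t)).
Proof.
move=> mD mY; apply: (@measurableT_comp _ _ _ _ _ _ (@Num.sqrt R)).
  by apply: continuous_measurable_fun; exact: sqrt_continuous.
suff h : forall r : seq 'I_n, measurable_fun D (fun t => \sum_(j <- r) Y t 0 j ^+ 2) by exact: h.
elim=> [|j r ih].
  by under eq_fun do rewrite big_nil; exact: measurable_cst.
under eq_fun do rewrite big_cons; apply: measurable_funD => //.
exact: measurable_funX.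
Qed.

Lemma measurable_radial (D : set R) Y (lambda p : R) b j : measurable D ->
  (forall j, measurable_fun D (fun t => Y t 0 j)) ->
  measurable_fun D (fun t => radial (profile lambda p) b (Y t) 0 j).
Proof.
move=> mD mY; have mE := measurable_enorm mD mY.
rewrite (_ : (fun t => _) = (fun t => profile lambda p (enorm (Y t)) * direction b (Y t) 0 j)).
  apply: measurable_funM.
    apply: measurable_funM; first exact: measurable_cst.
    by apply: (@measurableT_comp _ _ _ _ _ _ (@powR R ^~ (p - 1))) => //; exact: measurable_powR.
  rewrite /direction; case: b; first exact: mY.
  by rewrite (_ : (fun t => _) = (fun t => enorm (Y t)))//; apply/funext => t; rewrite mxE.
by apply/funext => t; rewrite mxE.
Qed.

End measurability.

Section problem.
Context (R : realType) (n : nat) (a0 a1 sigma lambda p : R) (b : bool).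
Hypotheses (hn : (1 <= n)%N) (ha0 : 0 < a0) (ha1 : a1 < 0)
  (hsigma : -1 + 2 / n%:R < sigma) (hp : 1 < p).

Local Notation T0 := (T0 n a0 a1 sigma).
Local Notation T1 := (T1 n a0 a1 sigma).
Local Notation A := (A n a0 a1 sigma).
Local Notation kap := (kappa n sigma).
Local Notation f := (radial (profile lambda p) b : 'rV[R]_n -> 'rV[R]_n).
Local Notation fM M := (radial (trunc_profile lambda p M) b : 'rV[R]_n -> 'rV[R]_n).
Local Notation rho0 := (rho0 n a0 a1 sigma).
Local Notation rho1 := (rho1 n a0 a1 sigma).
Local Notation K := (Num.sqrt n%:R : R).
Implicit Types (Y V Z : R -> 'rV[R]_n) (T : R).

Let T0p : 0 < T0. Proof. exact: T0_gt0. Qed.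
Let kp : 0 < kap. Proof. exact: (kappa_gt0 hn hsigma). Qed.

Lemma A_coef t : t < T0 -> A t = coef T0 kap t.
Proof. by move=> tT; rewrite AE. Qed.

Lemma rho_fund : exists r0' r1', fundamental T0 kap rho0 r0' rho1 r1'.
Proof.
have [r0' [h0 h0' e0 e0']] := rho0P hn ha0 ha1 hsigma.
have [r1' [h1 h1' e1 e1']] := rho1P hn ha0 ha1 hsigma.
rewrite T1E// in h0 h0' h1 h1'.
exists r0', r1'; split=> //; split => //.
  by apply: eq_has_deriv h0' => // t [_]; rewrite lte_fin => tT; rewrite A_coef.
by apply: eq_has_deriv h1' => // t [_]; rewrite lte_fin => tT; rewrite A_coef.
Qed.

Lemma radial_profile_bounded (M : R) y : 0 <= M -> enorm y <= M ->
  enorm (f y) <= K * (`|lambda| * M `^ (p - 1)) * M.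
Proof.
move=> M0 yM; rewrite -(radial_truncE _ _ _ yM).
apply: le_trans (radial_trunc_le hn lambda hp b y M0) _.
by rewrite ler_wpM2l// mulr_ge0 ?sqrtr_ge0// mulr_ge0// powR_ge0.
Qed.

(** The regularity statement: of the membership in X' only the measurability of
    [Y] and its essential boundedness are used. *)
Lemma X'_ode T (Y0 Y1 : 'rV[R]_n) Y : 0 < T -> T <= T0 -> X' a0 a1 sigma T%:E Y ->
  solution a0 a1 sigma f Y0 Y1 T%:E Y -> exists V, is_ode T0 kap T f Y0 Y1 Y V.
Proof.
move=> Tp TT [V [wd nV]] solY.
have mY j : measurable_fun (Ioo0 T%:E) (fun t => Y t 0 j) by case: (wd j) => -[].
have [M hM] : exists M, {ae @lebesgue_measure R, forall t, Ioo0 T%:E t -> enorm (Y t) <= M}.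
  have [|M hM] := @Lnorm_oo_lty _ T (fun t => enorm (Y t)).
    apply: le_lt_trans nV; rewrite /X'norm -addeA addeCA; apply: leeDl.
    by rewrite adde_ge0// Lnorm_ge0.
  exists M; apply: ae_impl hM => t h Tt; exact: le_trans (ler_norm _) (h Tt).
pose B := K * (`|lambda| * `|M| `^ (p - 1)) * `|M|.
have bF j : {ae @lebesgue_measure R, forall t, Ioo0 T%:E t -> `|f (Y t) 0 j| <= B}.
  apply: ae_impl hM => t h Tt; apply: le_trans (normr_le_enorm _ _) _.
  by apply: radial_profile_bounded => //; apply: le_trans (h Tt) (ler_norm _).
have iF j t : Ico0 T%:E t ->
    (@lebesgue_measure R).-integrable `[0, t] (EFin \o (fun s => f (Y s) 0 j)).
  move=> Tt; apply: (bounded_integrable _ (bF j) Tt).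
  by apply: measurable_radial => //; exact: measurable_Ioo0.
have [r0' [r1' fund]] := rho_fund.
have solG t : Ico0 T%:E t -> Y t = duhamel rho0 rho1 f Y0 Y1 Y t by exact: solY.
have cY := sol_cts T0p kp fund TT solG iF bF.
apply: (sol_ode fund TT solG iF) Tp.
by apply: vcts_radial cY; exact: cts_profile.
Qed.

Lemma X'ball_X' (T : \bar R) r Y : X'ball a0 a1 sigma T r Y -> X' a0 a1 sigma T Y.
Proof.
move=> [V [h1 h2]]; exists V; split => //; apply: le_lt_trans h2 _; exact: ltry.
Qed.

(** Solutions on two intervals agree on the smaller one. *)
Lemma solution_unique T T' (Y0 Y1 : 'rV[R]_n) Y Z : 0 < T -> T <= T' -> T' <= T0 ->
  X' a0 a1 sigma T%:E Y -> solution a0 a1 sigma f Y0 Y1 T%:E Y ->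
  X' a0 a1 sigma T'%:E Z -> solution a0 a1 sigma f Y0 Y1 T'%:E Z ->
  {in Ico0 T%:E, Z =1 Y}.
Proof.
move=> Tp TT TT' XY sY XZ sZ t; rewrite inE => Tt.
have [V hV] := X'_ode Tp (le_trans TT TT') XY sY.
have [W hW] := X'_ode (lt_le_trans Tp TT) TT' XZ sZ.
exact: (ode_unique kp hn hp (le_trans TT TT') (is_odeS TT hW) hV Tt).
Qed.

Lemma X'_C1 T (Y0 Y1 : 'rV[R]_n) Y : 0 < T -> T <= T0 -> X' a0 a1 sigma T%:E Y ->
  solution a0 a1 sigma f Y0 Y1 T%:E Y -> C1_on (Ico0 T%:E) Y.
Proof.
move=> Tp TT XY sY; have [V [h1 h2 _ _]] := X'_ode Tp TT XY sY.
by exists V => j; split => //; apply/cts_onP; exact: has_deriv_cts (h2 j).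
Qed.

(** The truncated problem has a solution on all of [0, T0). *)
Lemma trunc_solution (M : R) (Y0 Y1 : 'rV[R]_n) : 0 <= M ->
  exists Y V, is_ode T0 kap T0 (fM M) Y0 Y1 Y V /\
    solution a0 a1 sigma (fM M) Y0 Y1 T0%:E Y.
Proof.
move=> M0; have [r0' [r1' fund]] := rho_fund.
have fM0 : fM M 0 = 0 by rewrite /radial direction0 scaler0.
have [Y cY sY] := picard T0p kp fund (trunc_lip_const_ge0 n lambda hp M)
  (fun y z => radial_trunc_lip hn lambda hp b y z M0) fM0 Y0 Y1.
have cF : vcts (Ico0 T0%:E) (fun t => fM M (Y t)).
  by apply: vcts_radial cY; exact: cts_trunc_profile.
have iF j t : Ico0 T0%:E t ->
    (@lebesgue_measure R).-integrable `[0, t] (EFin \o (fun s => fM M (Y s) 0 j)).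
  by move=> Tt; exact: integrable_cc (cF j) Tt.
have [V hV] := sol_ode fund (lexx T0) sY iF cF T0p.
by exists Y, V.
Qed.

(** Where the truncation is not active, a solution of the truncated problem
    solves the original one. *)
Lemma trunc_is_solution (M T : R) (Y0 Y1 : 'rV[R]_n) Y : T <= T0 ->
  (forall t, Ico0 T%:E t -> enorm (Y t) <= M) ->
  solution a0 a1 sigma (fM M) Y0 Y1 T0%:E Y ->
  solution a0 a1 sigma f Y0 Y1 T%:E Y.
Proof.
move=> TT YM sY t Tt; rewrite (sY t (Ico0_sub TT Tt)).
have eqI j : \int[@lebesgue_measure R]_(s in `[0, t])
      (rho12 n a0 a1 sigma t s * fM M (Y s) 0 j) =
    \int[@lebesgue_measure R]_(s in `[0, t]) (rho12 n a0 a1 sigma t s * f (Y s) 0 j).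
  apply: eq_Rintegral => s; rewrite inE/= in_itv/= => st; congr (_ * _).
  by rewrite (radial_truncE lambda p b (YM s (Ico0P Tt st))).
by apply/rowP => j; rewrite [LHS]mxE [RHS]mxE eqI.
Qed.

(** If the energy and the total dissipation of a classical solution are at most
    [c ^+ 2], then each of the three parts of its X' norm is at most [c]. *)
Lemma X'norm_bound T g (Y0 Y1 : 'rV[R]_n) Y V (c : R) : 0 < T -> T <= T0 -> 0 <= c ->
  is_ode T0 kap T g Y0 Y1 Y V ->
  (forall t, Ico0 T%:E t -> energy T0 kap Y V t <= c ^+ 2) ->
  (forall t, Ico0 T%:E t -> prim (dissip T0 kap V) t <= c ^+ 2) ->
  X'ball a0 a1 sigma T%:E (3 * c) Y.
Proof.
move=> Tp TT c0 ode he hd; exists V; have [h1 h2 _ _] := ode.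
have cV j := has_deriv_cts (h2 j).
have lt0 t : Ico0 T%:E t -> t < T0.
  by move=> /(Ico0_sub TT) [_]; rewrite lte_fin.
have oo t : Ioo0 T%:E t -> Ico0 T%:E t by move=> [t0 tT]; split => //; exact: ltW.
split.
  move=> j; split; [exact: loc_integrable_cts (has_deriv_cts (h1 j))|
    exact: loc_integrable_cts (cV j)|move=> phi tphi].
  exact: (weak_deriv_comp Tp (h1 j) (cV j) tphi).
rewrite /X'norm.
have -> : 3 * c = c + c + c by ring.
rewrite !EFinD; apply: leeD; first apply: leeD.
- apply: Lnorm_oo_le => // t /oo Tt.
  have At := coef_gt0 kp (Ico0_sub TT Tt).
  rewrite (A_coef (lt0 _ Tt)) ger0_norm ?mulr_ge0 ?invr_ge0 ?sqrtr_ge0 ?enorm_ge0//.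
  rewrite -(ler_pXn2r (ltn0Sn 1)) ?nnegrE ?mulr_ge0 ?invr_ge0 ?sqrtr_ge0 ?enorm_ge0//.
  rewrite exprMn exprVn sqr_sqrtr ?(ltW At)//; apply: le_trans (he t Tt).
  by rewrite /energy lerDr sqr_ge0.
- apply: Lnorm_oo_le => // t /oo Tt.
  rewrite ger0_norm ?enorm_ge0// -(ler_pXn2r (ltn0Sn 1)) ?nnegrE ?enorm_ge0//.
  exact: le_trans (energy_ge kp TT Y V Tt) (he t Tt).
- apply: (Lnorm_2_le Tp c0 (cts_dissip ode)) hd => [t Tt|t /oo Tt].
    by apply: dissip_ge0 Tt.
  have tT := lt0 _ Tt; have d0 : T0 - t != 0 by rewrite subr_eq0 gt_eqF.
  rewrite !exprMn exprVn A_coef// derive1_AE// sqr_sqrtr; last first.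
    by apply: divr_ge0; [rewrite mulr_ge0// ltW|rewrite exprn_ge0// subr_ge0 ltW].
  rewrite /dissip /coef; field; rewrite d0 gt_eqF//.
Qed.

Lemma energy0_le (Y0 Y1 : 'rV[R]_n) g T Y V : is_ode T0 kap T g Y0 Y1 Y V ->
  energy T0 kap Y V 0 <= Dprime a0 a1 sigma Y0 Y1 ^+ 2.
Proof.
case=> _ _ e0 e1; rewrite /energy /Dprime e0 e1 A_coef//.
set s := Num.sqrt _.
have A0 := coef_gt0 kp (Ico0_T0 T0p).
have -> : (coef T0 kap 0)^-1 * enorm Y1 ^+ 2 = (s^-1 * enorm Y1) ^+ 2.
  by rewrite -[X in X^-1](sqr_sqrtr (ltW A0)) -/s exprMn exprVn.
have := enorm_ge0 Y0.
have : 0 <= s^-1 * enorm Y1 by rewrite mulr_ge0 ?invr_ge0 ?sqrtr_ge0 ?enorm_ge0.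
move: (s^-1 * _) (enorm Y0) => x y; nra.
Qed.

Lemma Dprime_ge0 (Y0 Y1 : 'rV[R]_n) : 0 <= Dprime a0 a1 sigma Y0 Y1 :> R.
Proof. by rewrite addr_ge0 ?enorm_ge0// mulr_ge0 ?invr_ge0 ?sqrtr_ge0 ?enorm_ge0. Qed.

(** The radius of the ball is 9 D': each part of the norm is at most 3 D' by
    [energy_small].  The truncation is at the same level M = 9 D'. *)
Lemma local_solution T (Y0 Y1 : 'rV[R]_n) : 0 < T -> T <= T0 ->
  let D' := Dprime a0 a1 sigma Y0 Y1 in
  growth T0 kap (K * (`|lambda| * (9 * D') `^ (p - 1))) T <= 1 ->
  exists Y, X'ball a0 a1 sigma T%:E (9 * D') Y /\
    solution a0 a1 sigma f Y0 Y1 T%:E Y.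
Proof.
move=> Tp TT D' W1; have D0 : 0 <= D' := Dprime_ge0 Y0 Y1.
have M0 : 0 <= 9 * D' by exact: mulr_ge0.
set L := K * _ in W1.
have L0 : 0 <= L by rewrite mulr_ge0 ?sqrtr_ge0// mulr_ge0// powR_ge0.
have [Y [V [hode hsol]]] := trunc_solution Y0 Y1 M0.
have {}hode := is_odeS TT hode.
have E0 := energy0_le hode; rewrite -/D' in E0.
have key t : Ico0 T%:E t -> energy T0 kap Y V t <= (3 * D') ^+ 2 /\
    prim (dissip T0 kap V) t <= (3 * D') ^+ 2.
  move=> Tt.
  have [] := energy_small kp TT hode L0 (fun t _ => radial_trunc_le hn lambda hp b (Y t) M0) Tt.
    apply: le_trans W1; rewrite /growth ler_wpM2l ?divr_ge0 ?sqrtr_ge0//.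
    case: Tt => t0; rewrite lte_fin => tT.
    have : 0 <= (T - t) * (T0 - t + (T0 - T)) by apply: mulr_ge0; lra.
    nra.
  move=> h1 h2.
  have -> : (3 * D') ^+ 2 = 9 * D' ^+ 2 by ring.
  by split; [apply: le_trans h1 _|apply: le_trans h2 _]; rewrite ler_pM2l.
exists Y; split.
  (* The three parts of the norm contribute 3 D' each. *)
  have -> : 9 * D' = 3 * (3 * D') by ring.
  apply: (X'norm_bound Tp TT _ hode); first exact: mulr_ge0.
    by move=> t /key [].
  by move=> t /key [].
apply: (trunc_is_solution TT _ hsol) => t Tt.
have [h _] := key t Tt.
apply: (@le_trans _ _ (3 * D')); last by lra.
rewrite -(ler_pXn2r (ltn0Sn 1)) ?nnegrE ?enorm_ge0 ?mulr_ge0//.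
exact: le_trans (energy_ge kp TT Y V Tt) h.
Qed.

(** The bound does not depend on the truncation level [M]. *)
Lemma potential_trunc_le (M s : R) : 0 <= lambda -> 0 <= M -> 0 <= s ->
  potential (trunc_profile lambda p M) s <= lambda * Num.sqrt s `^ (p - 1) * s.
Proof.
move=> l0 M0 s0; set c := lambda * _.
have cs : cts_on (Ico0 +oo%E) (fun u : R => trunc_profile lambda p M (Num.sqrt u)).
  apply: cts_comp_in (cts_trunc_profile (lambda := lambda) hp M0) _.
    by move=> u _; exact: sqrtr_ge0.
  by apply: (cts_comp (F := Num.sqrt)) (@cts_id _ _); exact: sqrt_continuous.
have Is : Ico0 +oo%E s by split => //; exact: ltry.
have -> : c * s = prim (fun=> c) s.
  rewrite (has_deriv_prim (T := +oo%E) (f := fun t => c * t) _ _ Is) ?mulr0 ?subr0//.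
    by apply: eq_has_deriv (has_deriv_scale c has_deriv_id) => // t _; rewrite mulr1.
  exact: cts_cst.
apply: le_Rintegral => //.
- exact: integrable_cc cs Is.
- exact: integrable_cc (@cts_cst _ _ c) Is.
- move=> u; rewrite /= in_itv/= => /andP[u0 us].
  rewrite /c /trunc_profile ler_wpM2l// ge0_ler_powR ?nnegrE ?sqrtr_ge0//.
  + by rewrite subr_ge0 ltW.
  + by rewrite le_min sqrtr_ge0.
  + by apply: (@le_trans _ _ (Num.sqrt u)); [rewrite ge_min lexx|rewrite ler_sqrt].
Qed.

(** The truncation level is chosen equal to the energy bound, which is possible
    because the latter does not depend on it. *)
Lemma global_solution (Y0 Y1 : 'rV[R]_n) : b = true -> 0 <= lambda ->
  exists Z, X' a0 a1 sigma T0%:E Z /\ solution a0 a1 sigma f Y0 Y1 T0%:E Z.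
Proof.
move=> bt l0.
pose D' := Dprime a0 a1 sigma Y0 Y1.
pose P0 := lambda * enorm Y0 `^ (p - 1) * enorm Y0 ^+ 2.
pose E := D' ^+ 2 + (coef T0 kap 0)^-1 * P0.
have A0 := coef_gt0 kp (Ico0_T0 T0p).
have E0 : 0 <= E.
  rewrite addr_ge0 ?sqr_ge0// mulr_ge0 ?invr_ge0 ?(ltW A0)//.
  by rewrite mulr_ge0 ?sqr_ge0// mulr_ge0 ?powR_ge0.
pose c := Num.sqrt E.
have c0 : 0 <= c := sqrtr_ge0 E.
have c2 : c ^+ 2 = E by rewrite sqr_sqrtr.
have [Y [V [hode hsol]]] := trunc_solution Y0 Y1 c0.
have key t : Ico0 T0%:E t -> energy T0 kap Y V t <= c ^+ 2 /\
    prim (dissip T0 kap V) t <= c ^+ 2.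
  move=> Tt.
  have hh0 x : 0 <= x -> 0 <= trunc_profile lambda p c x by move=> _; rewrite mulr_ge0 ?powR_ge0.
  have fE : fM c = radial (trunc_profile lambda p c) true by rewrite bt.
  have [h1 h2] := defocusing_bound kp (lexx T0) hode
    (cts_trunc_profile (lambda := lambda) hp c0) hh0 fE Tt.
  have le : energy T0 kap Y V 0 + (coef T0 kap 0)^-1 *
      potential (trunc_profile lambda p c) (enorm (Y 0) ^+ 2) <= c ^+ 2.
    rewrite c2; apply: lerD; first exact: energy0_le hode.
    rewrite ler_pM2l ?invr_gt0//.
    case: (hode) => _ _ -> _.
    apply: le_trans (potential_trunc_le l0 c0 (sqr_ge0 _)) _.
    by rewrite sqrtr_sqr ger0_norm ?enorm_ge0.
  by split; [exact: le_trans h1 le|exact: le_trans h2 le].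
exists Y; split.
  apply: X'ball_X'; apply: (X'norm_bound T0p (lexx T0) c0 hode).
    by move=> t /key [].
  by move=> t /key [].
apply: (trunc_is_solution (lexx T0) _ hsol) => t Tt.
have [h _] := key t Tt.
rewrite -(ler_pXn2r (ltn0Sn 1)) ?nnegrE ?enorm_ge0//.
exact: le_trans (energy_ge kp (lexx T0) Y V Tt) h.
Qed.

(** The constant [C] of the theorem, for which the left-hand side of the condition
    on T in (1) is exactly the value at T of [growth] ([local_time_growth]). *)
Definition time_const : R := K * scale_exp n sigma / Num.sqrt kap.

Lemma time_const_gt0 : 0 < time_const.
Proof.
rewrite divr_gt0 ?sqrtr_gt0// mulr_gt0 ?(scale_exp_gt0 hn hsigma)//.
by rewrite sqrtr_gt0 ltr0n.
Qed.

Lemma local_time_growth T (m : R) :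
  time_const * `|lambda| * a0 * T / `|a1| * (1 - T / (2 * T0)) * m
  = growth T0 kap (K * (`|lambda| * m)) T.
Proof.
have T00 : T0 != 0 by rewrite gt_eqF.
have a10 : `|a1| != 0 by rewrite normr_eq0 lt_eqF.
have sk : Num.sqrt kap != 0 by rewrite gt_eqF// sqrtr_gt0.
have r0 : scale_exp n sigma != 0 by rewrite gt_eqF// (scale_exp_gt0 hn hsigma).
have e := T0E a0 hn ha1 hsigma.
rewrite /time_const /growth; move: T00 e; generalize T0 => t0 t00 e.
have -> : a0 = t0 * `|a1| / scale_exp n sigma by rewrite e; field; rewrite a10 r0.
by field; rewrite t00 a10 r0 sk.
Qed.

(** The smallness condition of (2) even gives growth at most 1/2 on [0, T0). *)
Lemma small_growth (m : R) : 0 <= m ->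
  2 * time_const * `|lambda| * a0 ^+ 2 / (n%:R * (1 + sigma) * `|a1| ^+ 2) * m <= 1 ->
  growth T0 kap (K * (`|lambda| * m)) T0 <= 1.
Proof.
move=> m0; rewrite -local_time_growth => small.
have T00 : T0 != 0 by rewrite gt_eqF.
have s1 : n%:R * (1 + sigma) != 0.
  by rewrite gt_eqF// mulr_gt0 ?ltr0n// (sigma1_gt0 hn hsigma).
have a10 : `|a1| != 0 by rewrite normr_eq0 lt_eqF.
have E : time_const * `|lambda| * a0 * T0 / `|a1| * (1 - T0 / (2 * T0)) * m =
   2^-1 * (2 * time_const * `|lambda| * a0 ^+ 2 / (n%:R * (1 + sigma) * `|a1| ^+ 2) * m).
  have -> : 1 - T0 / (2 * T0) = 2^-1 by field.
  rewrite (T0E a0 hn ha1 hsigma) /scale_exp.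
  have n0 : n%:R != 0 :> R by rewrite pnatr_eq0 -lt0n.
  field; rewrite a10/= n0 /=; have := sigma1_gt0 hn hsigma => s0; rewrite gt_eqF//.
rewrite E; lra.
Qed.

(** The condition of (1) on T is satisfied by some positive time. *)
Lemma local_time_ex (c : R) : 0 <= c -> exists T : R,
  [/\ 0 < T, T < T0 & c * (T * (1 - T / (2 * T0))) <= 1].
Proof.
move=> c0; pose T := Num.min (T0 / 2) (c + 1)^-1.
have c1 : 0 < c + 1 by rewrite ltr_wpDl.
have Tp : 0 < T by rewrite lt_min divr_gt0//= invr_gt0.
have TT : T < T0.
  by rewrite gt_min; apply/orP; left; rewrite ltr_pdivrMr// ltr_pMr// ltr1n.
exists T; split => //.
have h1 : T * (1 - T / (2 * T0)) <= T.
  by rewrite ler_piMr ?(ltW Tp)// lerBlDr lerDl divr_ge0// ?mulr_ge0// ltW.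
apply: le_trans (ler_wpM2l c0 h1) _.
apply: (@le_trans _ _ (c * (c + 1)^-1)); first by rewrite ler_wpM2l// ge_min lexx orbT.
by rewrite ler_pdivrMr// mul1r lerDl.
Qed.

End problem.

Unset Implicit Arguments.

Theorem theorem3 (R : realType) (n : nat) (a0 a1 sigma lambda p : R)
    (f : 'rV[R]_n -> 'rV[R]_n)
    (hn : (1 <= n)%N) (ha0 : 0 < a0) (ha1 : a1 < 0)
    (hsigma : -1 + 2 / n%:R < sigma) (hp : 1 < p)
    (hf : f = f_vec lambda p \/ f = f_abs lambda p) :
  exists C0 C : R, 0 < C0 /\ 0 < C /\
  forall Y0 Y1 : 'rV[R]_n,
  let D' := Dprime a0 a1 sigma Y0 Y1 in
  let T0 := T0 n a0 a1 sigma in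
  let T1 := T1 n a0 a1 sigma in
  let sol := solution a0 a1 sigma f Y0 Y1 in
  let ball T := X'ball a0 a1 sigma T (C0 * D') in
  let wellposed T :=
    exists_unique_solution a0 a1 sigma f Y0 Y1 T (ball T) in
  (* the times T to which (1) applies *)
  let local_time T :=
    [/\ 0 < T, (T%:E < T1)%E &
        C * `|lambda| * a0 * T / `|a1| * (1 - T / (2 * T0))
          * (C0 * D') `^ (p - 1) <= 1] in
  let small :=
    2 * C * `|lambda| * a0 ^+ 2 / (n%:R * (1 + sigma) * `|a1| ^+ 2)
      * (C0 * D') `^ (p - 1) <= 1 in
  (* [Y] is the solution of (1), where T = T1 is possible in case (2) *)
  let the_solution (T : \bar R) Y :=
    [/\ (exists2 T', T = T'%:E & local_time T') \/ (T = T1 /\ small),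
        ball T Y & sol T Y] in
  [/\ (* (1) *)
      (exists T, local_time T /\ wellposed T%:E) /\
      (forall T, local_time T -> wellposed T%:E),
      (* (2) *)
      small ->
        wellposed T1 /\
        (forall T Y Z, the_solution T Y -> the_solution T1 Z ->
           {in Ico0 T, Z =1 Y}),
      (* (3) *)
      forall T Y, the_solution T Y -> C1_on (Ico0 T) Y,
      (* (4) *)
      forall T Y Z, the_solution T Y ->
        C1_on (Ico0 T) Z -> X' a0 a1 sigma T Z -> sol T Z ->
        {in Ico0 T, Z =1 Y} &
      (* (5) *)
      0 <= lambda -> f = f_vec lambda p ->
        exists Z, [/\ X' a0 a1 sigma T1 Z, sol T1 Z &
          forall T Y, the_solution T Y -> {in Ico0 T, Z =1 Y}]].
Proof.
have [b fE] : exists b, f = radial (profile lambda p) b.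
  case: hf => ->; [exists true|exists false]; [exact: f_vecE|exact: f_absE].
have bE : f = f_vec lambda p -> f = radial (profile lambda p) true by move=> ->; exact: f_vecE.
exists 9, (time_const n sigma); split=> //; split; first exact: time_const_gt0.
move=> Y0 Y1 D' t0 t1 sol ball wellposed local_time small the_solution.
have t0p : 0 < t0 by exact: T0_gt0.
have t1E : t1 = t0%:E by exact: T1E.
have D0 : 0 <= D' := Dprime_ge0 a0 a1 sigma Y0 Y1.
have m0 : 0 <= (9 * D') `^ (p - 1) by exact: powR_ge0.
(* All the times in question are finite and at most T0. *)
have time T : (exists2 T', T = T'%:E & local_time T') \/ (T = t1 /\ small) ->
    exists T', [/\ T = T'%:E, 0 < T' & T' <= t0].
  case=> [[T' -> [T'0 T'1 _]]|[-> _]]; last by exists t0; rewrite t1E.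
  by exists T'; split => //; apply: ltW; rewrite -lte_fin -t1E.
have uniq T T' Y Z : 0 < T -> T <= T' -> T' <= t0 ->
    X' a0 a1 sigma T%:E Y -> sol T%:E Y -> X' a0 a1 sigma T'%:E Z -> sol T'%:E Z ->
    {in Ico0 T%:E, Z =1 Y}.
  move=> T0' TT TT' XY sY XZ sZ; rewrite /sol fE in sY sZ.
  exact: (solution_unique hn ha0 ha1 hsigma hp T0' TT TT' XY sY XZ sZ).
have wp T : 0 < T -> T <= t0 ->
    growth t0 (kappa n sigma) (Num.sqrt n%:R * (`|lambda| * (9 * D') `^ (p - 1))) T <= 1 ->
    wellposed T%:E.
  move=> T0' TT W1.
  have [Y [bY sY]] := local_solution b hn ha0 ha1 hsigma hp T0' TT W1.
  rewrite -fE in sY; exists Y; split => // Z bZ sZ.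
  by apply: uniq (X'ball_X' bY) sY (X'ball_X' bZ) sZ.
have wp_local T : local_time T -> wellposed T%:E.
  move=> [T0' T1' loc]; apply: wp => //; first by rewrite -lee_fin -t1E ltW.
  by rewrite -(local_time_growth lambda hn ha0 ha1 hsigma).
split.
- split=> //.
  pose c := time_const n sigma * `|lambda| * a0 / `|a1| * (9 * D') `^ (p - 1).
  have c0 : 0 <= c.
    rewrite mulr_ge0// divr_ge0// mulr_ge0 ?(ltW ha0)// mulr_ge0// ltW//.
    exact: time_const_gt0.
  have [T [T0' TT le]] := local_time_ex hn ha0 ha1 hsigma c0.
  have loc : local_time T.
    split=> //; first by rewrite t1E lte_fin.
    by apply: le_trans le; apply: le_of_eq; rewrite /c -/t0; ring.
  by exists T; split => //; exact: wp_local.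
- move=> sm; split.
    rewrite t1E; apply: wp => //; exact: (small_growth hn ha0 ha1 hsigma).
  move=> T Y Z [/time [T' [-> T'0 T't0]] bY sY] [_ bZ sZ].
  rewrite t1E in bZ sZ.
  exact: (uniq _ _ _ _ T'0 T't0 (lexx t0) (X'ball_X' bY) sY (X'ball_X' bZ) sZ).
- move=> T Y [/time [T' [-> T'0 T't0]] bY sY].
  rewrite /sol fE in sY.
  exact: (X'_C1 hn ha0 ha1 hsigma hp T'0 T't0 (X'ball_X' bY) sY).
- move=> T Y Z [/time [T' [-> T'0 T't0]] bY sY] _ XZ sZ.
  exact: (uniq _ _ _ _ T'0 (lexx T') T't0 (X'ball_X' bY) sY XZ sZ).
- move=> l0 /bE fE'.
  have [Z [XZ sZ]] := global_solution hn ha0 ha1 hsigma hp Y0 Y1 erefl l0.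
  rewrite -fE' in sZ.
  exists Z; rewrite t1E; split=> // T Y [/time [T' [-> T'0 T't0]] bY sY].
  exact: (uniq _ _ _ _ T'0 T't0 (lexx t0) (X'ball_X' bY) sY XZ sZ).
Qed.
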